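(* Let $X,Y$ be two disjoint compact sets in $\Omega\subset\mathbb{R}^3$ and let $\mathbf{x}_c\in X$, $\mathbf{y}_c\in Y$ be their centers respectively. Let $|\mathbf{x}_c-\mathbf{y}_c|=\rho=O(1)$, $\sup_{\mathbf{x}\in X}|\mathbf{x}_c-\mathbf{x}|=\zeta$ and $\sup_{\mathbf{y}\in Y}|\mathbf{y}_c-\mathbf{y}|=\eta$. Assume $n\ge1$ and $\frac{\zeta+\eta}{\rho}<\frac12$. Then for any $\varepsilon>0$ there exist $N^{\varepsilon}\le O\big((n+|\log\varepsilon|)^4\,\varepsilon^{-6/(k+1)}\big)$ and functions $f_l\in L^{\infty}(X)$, $g_l\in L^{\infty}(Y)$, $l=1,2,\dots,N^{\varepsilon}$, such that $$\Big|\frac{E(\mathbf{x},\mathbf{y})}{|\mathbf{x}-\mathbf{y}|^2}\,Y_{n0}\Big(\frac{\mathbf{x}-\mathbf{y}}{|\mathbf{x}-\mathbf{y}|}\Big)-\sum_{l=1}^{N^{\varepsilon}}f_l(\mathbf{x})\,g_l(\mathbf{y})\Big|\le\varepsilon\qquad\text{for }\mathbf{x}\in X,\ \mathbf{y}\in Y,$$ where the constant in the bound for $N^{\varepsilon}$ depends on $X$ and $Y$.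
   Context: $\Omega\subset\mathbb{R}^3$ is a bounded convex domain. The coefficient $\sigma_t$ is a real-valued function in $C^{k+1}(\overline{\Omega})$ with $k\ge1$ an integer, and $0<\sigma_0\le\sigma_t\le\sigma_1<\infty$ for some constants $\sigma_0,\sigma_1$; $\Omega$, $\sigma_t$ and $k$ are fixed. For $\mathbf{x}\ne\mathbf{y}$ in $\Omega$, $$E(\mathbf{x},\mathbf{y})=\exp\Big(-|\mathbf{x}-\mathbf{y}|\int_0^1\sigma_t(\mathbf{x}+(\mathbf{y}-\mathbf{x})s)\,ds\Big).$$ $n$ is an integer and $Y_{n0}(\theta,\phi)=\sqrt{\tfrac{2n+1}{4\pi}}\,P_n(\cos\theta)$, where $\theta$ is the polar angle measured from the $z$-axis, $\phi$ the azimuthal angle, and $P_n$ the Legendre polynomial of degree $n$. The ''centers'' are simply designated points of $X$ and $Y$; $\rho=O(1)$ says only that $\rho$ is a fixed quantity of order one. The bound on $N^{\varepsilon}$ is asymptotic as $\varepsilon\to0$: there is a constant $C$, independent of $n$ and $\varepsilon$, such that $N^{\varepsilon}\le C\,(n+|\log\varepsilon|)^4\varepsilon^{-6/(k+1)}$ for all sufficiently small $\varepsilon$. *)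

(* Defs.v *)
From HB Require Import structures.
From mathcomp Require Import all_boot all_order all_algebra.
From mathcomp Require Import all_classical all_reals all_analysis.

Set Implicit Arguments.
Unset Strict Implicit.
Unset Printing Implicit Defensive.

Import Order.TTheory GRing.Theory Num.Theory.
Import numFieldNormedType.Exports.

Local Open Scope classical_set_scope.
Local Open Scope ring_scope.

Definition coord_x : 'I_3 := inord 0.
Definition coord_y : 'I_3 := inord 1.
Definition coord_z : 'I_3 := inord 2.

(* The library norm [`|v|] on ['rV[R]_3] is the sup norm, hence this definition;
   the topology (compact, open, closure, bounded) is the same for both. *)
Definition enorm (R : realType) (v : 'rV[R]_3) : R :=
  Num.sqrt (\sum_(i < 3) v 0 i ^+ 2).

Definition partial (R : realType) (i : 'I_3) (f : 'rV[R]_3 -> R)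
    (x : 'rV[R]_3) : R :=
  'D_(delta_mx 0 i : 'rV[R]_3) (f : 'rV[R]_3 -> R^o) x.

Definition iter_partial (R : realType) (s : seq 'I_3) (f : 'rV[R]_3 -> R) :
    'rV[R]_3 -> R := foldr (@partial R) f s.

(* [f] is of class C^m on the closure of the open set [W]: it is continuous
   there, all its iterated partial derivatives of order at most [m] exist in [W],
   and each of them extends continuously to [closure W].  Only the values of [f]
   on [closure W] matter. *)
Definition Ck_closure (R : realType) (m : nat) (W : set 'rV[R]_3)
    (f : 'rV[R]_3 -> R) : Prop :=
  [/\ {within closure W, continuous f},
      forall (s : seq 'I_3) (i : 'I_3) (x : 'rV[R]_3),
        (size s < m)%N -> W x ->
        derivable (iter_partial s f : 'rV[R]_3 -> R^o) x (delta_mx 0 i)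
    & forall s : seq 'I_3, (size s <= m)%N ->
        exists g : 'rV[R]_3 -> R, {within closure W, continuous g} /\
          (forall x, W x -> g x = iter_partial s f x)].

Definition attenuation (R : realType) (sigma_t : 'rV[R]_3 -> R)
    (x y : 'rV[R]_3) : R :=
  expR (- (enorm (x - y) *
    Rintegral (@lebesgue_measure R) `[0, 1]
      (fun s : R => sigma_t (x + s *: (y - x))))).

(* Rodrigues' formula *)
Definition legendre (R : realType) (n : nat) : {poly R} :=
  (2 ^+ n * n`!%:R)^-1 *: (('X^2 - 1) ^+ n)^`(n).

(* Spherical harmonic of order 0; it does not depend on the azimuthal angle. *)
Definition Y_n0 (R : realType) (n : nat) (theta : R) : R :=
  Num.sqrt ((2 * n%:R + 1) / (4 * pi)) * (legendre R n).[cos theta].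

(* Polar angle, measured from the z-axis, of a unit vector. *)
Definition polar_angle (R : realType) (w : 'rV[R]_3) : R := acos (w 0 coord_z).

Definition vec3 (R : realType) (p : R * R * R) : 'rV[R]_3 :=
  \row_i (if i == coord_x then p.1.1 else if i == coord_y then p.1.2 else p.2).

Definition lebesgue_measure3 (R : realType) :=
  ((@lebesgue_measure R \x @lebesgue_measure R) \x @lebesgue_measure R)%E.

(* L^oo(A) for a subset [A] of R^3: the extension of [f] by 0 outside [A] is
   measurable and essentially bounded.  The library's product measures live on
   [R * R * R], which [vec3] identifies with ['rV[R]_3]. *)
Definition Linfty (R : realType) (A : set 'rV[R]_3) (f : 'rV[R]_3 -> R) : Prop :=
  (patch (fun=> 0) A f \o @vec3 R) \in Lfun (@lebesgue_measure3 R) +oo%E.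

(* Main.v *)
Require Import Defs.
From HB Require Import structures.
From mathcomp Require Import all_boot all_order all_algebra.
From mathcomp Require Import all_solvable all_field qpoly.
From mathcomp Require Import all_classical all_reals all_analysis.
From mathcomp Require Import ess_sup_inf measurable_realfun.
From mathcomp Require Import ring lra zify complex.

(** Fix y and interpolate the kernel K(x, y) in x alone.  With m = k + 1, cover
    X by cubes of side h and use, in each cube, tensor Lagrange interpolation at
    m^3 nodes.  Then f_l is a Lagrange basis function cut off to one cube and
    g_l = K(a_l, .) for a node a_l, so that only continuity in y matters.  The
    sum has O(h^-3) terms.

    The error is O(sqrt n (n h)^m), where sqrt n comes from the normalisation of
    the spherical harmonic and each derivative in x costs a factor n.  Taking
    n h of order (eps / sqrt n)^(1/m) yields N = O(n^(3 + 3/(2m)) eps^(-3/m)).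
    This is within the bound because m >= 2.

    Tensor interpolation only asks how well K is approximated by polynomials on
    segments parallel to the axes (cube_error).  On such a segment put
    t = kappa s / n; the functions of s in [0, 1] so obtained, for all n, all
    base points and all y, form a family with uniform expansions up to O(s^m), a
    property called jet below.  Jets are stable under sums, products and
    composition with smooth families, and the factors of K are jets:
    - the power (r / r0)^-(n+2) of the distance, since (r / r0)^2 = 1 + O(1/n)
      and the exponent is O(n) (jet_dist_powR);
    - the solid harmonic (r / r0)^n P_n(z / r), since Laplace's formula writes
      r^n P_n(z / r) as an average of n-th powers of complex linear forms
      bounded by r (solid_harmonic_line, jet_solid_harmonic);
    - the attenuation, the exponential of -r times a line integral of sigma_t:
      sigma_t is expanded along the segment pointwise and the Taylor
      coefficients are integrated (jet_line_integral). *)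

Set Implicit Arguments.
Unset Strict Implicit.
Unset Printing Implicit Defensive.

Import Order.TTheory GRing.Theory Num.Theory.
Import numFieldNormedType.Exports.

Local Open Scope classical_set_scope.
Local Open Scope ring_scope.

(** * The coefficient norm of a polynomial *)

Section CoefNorm.
Variable K : numDomainType.
Implicit Types (p q : {poly K}) (c x : K).

Definition coef_norm p : K := \sum_(i < size p) `|p`_i|.

Lemma coef_norm_widen N p : (size p <= N)%N ->
  coef_norm p = \sum_(i < N) `|p`_i|.
Proof.
move=> leN; rewrite /coef_norm (big_ord_widen _ (fun i => `|p`_i|) leN).
rewrite big_mkcond; apply: eq_bigr => i _; case: ltnP => // lei.
by rewrite nth_default ?normr0.
Qed.

Lemma coef_norm_ge0 p : 0 <= coef_norm p.
Proof. by apply: sumr_ge0 => i _. Qed.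

Lemma coef_norm0 : coef_norm 0 = 0.
Proof. by rewrite /coef_norm size_poly0 big_ord0. Qed.

Lemma coef_normD p q : coef_norm (p + q) <= coef_norm p + coef_norm q.
Proof.
pose N := maxn (size p) (size q).
rewrite (@coef_norm_widen N (p + q)) ?size_polyD //.
rewrite (@coef_norm_widen N p) ?leq_maxl // (@coef_norm_widen N q) ?leq_maxr //.
by rewrite -big_split /=; apply: ler_sum => i _; rewrite coefD ler_normD.
Qed.

Lemma coef_normZ c p : coef_norm (c *: p) = `|c| * coef_norm p.
Proof.
rewrite (@coef_norm_widen (size p)) ?size_scale_leq // mulr_sumr.
by apply: eq_bigr => i _; rewrite coefZ normrM.
Qed.

Lemma coef_normC c : coef_norm c%:P = `|c|.
Proof.
rewrite (@coef_norm_widen 1) ?size_polyC_leq1 //.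
by rewrite big_ord1 coefC.
Qed.

Lemma coef_normMXaddC p c : coef_norm (p * 'X + c%:P) = coef_norm p + `|c|.
Proof.
rewrite (@coef_norm_widen (size p).+1); last by rewrite size_MXaddC; case: ifP.
rewrite big_ord_recl coefD coefMX coefC /= add0r addrC; congr (_ + _).
by apply: eq_bigr => i _; rewrite coefD coefMX coefC /= addr0.
Qed.

Lemma coef_norm_sum (I : Type) (r : seq I) (P : pred I) (F : I -> {poly K}) :
  coef_norm (\sum_(i <- r | P i) F i) <= \sum_(i <- r | P i) coef_norm (F i).
Proof.
elim/big_rec2: _ => [|i y p _ le_py]; first by rewrite coef_norm0.
exact: le_trans (coef_normD _ _) (lerD _ _).
Qed.

(** The norm makes the polynomials a normed algebra: this is what lets
    estimates of products of expansions be independent of degrees. *)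
Lemma coef_normM p q : coef_norm (p * q) <= coef_norm p * coef_norm q.
Proof.
elim/poly_ind: p => [|p c IHp]; first by rewrite mul0r coef_norm0 mul0r.
rewrite coef_normMXaddC mulrDl mulrDl (mulrAC p) mul_polyC.
apply: le_trans (coef_normD _ _) (lerD _ _); last by rewrite coef_normZ.
by rewrite -[p * q * 'X]addr0 -(polyC0 K) coef_normMXaddC normr0 addr0.
Qed.

Lemma coef_normX p n : coef_norm (p ^+ n) <= coef_norm p ^+ n.
Proof.
elim: n => [|n IHn]; first by rewrite !expr0 -(polyC1 K) coef_normC normr1.
rewrite !exprS; apply: le_trans (coef_normM _ _) _.
by apply: ler_wpM2l => //; exact: coef_norm_ge0.
Qed.

Lemma coef_norm_linear c d : coef_norm (c%:P + d *: 'X) = `|c| + `|d|.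
Proof.
by rewrite addrC -mul_polyC coef_normMXaddC coef_normC addrC.
Qed.

Lemma horner_coef_norm p x : `|x| <= 1 -> `|p.[x]| <= coef_norm p.
Proof.
move=> x1; rewrite horner_coef; apply: le_trans (ler_norm_sum _ _ _) _.
apply: ler_sum => i _; rewrite normrM normrX ler_piMr //.
by rewrite exprn_ile1.
Qed.

Lemma coef_norm_drop m p : coef_norm (drop_poly m p) <= coef_norm p.
Proof.
rewrite (@coef_norm_widen (size p) (drop_poly m p)); last first.
  by rewrite size_drop_poly leq_subr.
rewrite (@coef_norm_widen (m + size p) p) ?leq_addl // big_split_ord /=.
under eq_bigr do rewrite coef_drop_poly addnC.
by rewrite lerDr sumr_ge0.
Qed.

Lemma horner_take_poly m p x : `|x| <= 1 ->
  `|p.[x] - (take_poly m p).[x]| <= coef_norm p * `|x| ^+ m.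
Proof.
move=> x1; rewrite -[in p.[x]](poly_take_drop m p) hornerD addrAC subrr add0r.
rewrite hornerM hornerXn normrM normrX ler_wpM2r ?exprn_ge0 //.
exact: le_trans (horner_coef_norm _ x1) (coef_norm_drop _ _).
Qed.

End CoefNorm.

(** * Solid harmonics as averages of powers of linear forms *)

Lemma coef_comp_XaddC (K : comNzRingType) (p : {poly K}) (u : K) n :
  (p \Po ('X + u%:P))`_n = p^`N(n).[u].
Proof.
rewrite /comp_poly addrC.
rewrite (@nderiv_taylor_wide _ (maxn n.+1 (size p))); last 2 first.
- exact: mulrC.
- by rewrite size_map_polyC leq_maxr.
rewrite coef_sum (bigD1 (Ordinal (leq_maxl n.+1 (size p)))) //= big1 => [|i ni].
  by rewrite nderivn_map horner_map /= coefCM coefXn eqxx mulr1 addr0.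
rewrite nderivn_map horner_map /= coefCM coefXn.
by have /negPf -> : n != i; rewrite ?mulr0 // eq_sym.
Qed.

(** Rodrigues' formula takes the n-th Taylor coefficient at u of (X^2 - 1)^n,
    and (X + u)^2 - 1 is the trinomial on the right. *)
Lemma legendre_coef (R : realType) n (u : R) :
  2 ^+ n * (legendre R n).[u] = (('X^2 + (2 * u) *: 'X + (u ^+ 2 - 1)%:P) ^+
    n)`_n.
Proof.
have -> : 'X^2 + (2 * u) *: 'X + (u ^+ 2 - 1)%:P =
          ('X^2 - 1) \Po ('X + u%:P).
  rewrite comp_polyB comp_Xn_poly -(polyC1 R) comp_polyC -mul_polyC polyCB.
  by rewrite polyCM !polyC_exp; ring.
have -> : (('X^2 - 1) \Po ('X + u%:P)) ^+ n =
    ('X^2 - 1) ^+ n \Po ('X + u%:P).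
  by rewrite (rmorphXn (comp_poly ('X + u%:P))).
rewrite coef_comp_XaddC /legendre hornerZ nderivn_def hornerMn.
rewrite -[X in _ * (_ * X)]mulr_natr.
have n0 : n`!%:R != 0 :> R by rewrite pnatr_eq0 -lt0n fact_gt0.
have t0 : 2 ^+ n != 0 :> R by rewrite expf_neq0.
by rewrite invfM [_ * _%:R]mulrC -!mulrA mulKf // mulVKf.
Qed.

(** Rescaling the variable multiplies the outer coefficients of a quadratic
    polynomial by inverse factors; the middle coefficient of its powers
    therefore sees only their product. *)
Lemma middle_coef_trinomial (K : comNzRingType) (a b c a' c' : K) n :
  a * c = a' * c' ->
  ((a *: 'X^2 + b *: 'X + c%:P) ^+ n)`_n =
  ((a' *: 'X^2 + b *: 'X + c'%:P) ^+ n)`_n.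
Proof.
move=> ac; rewrite ![_ + b *: 'X + _]addrAC !exprDn !coef_sum.
have diag (x y : K) l : ((x *: 'X^2 + y%:P) ^+ l)`_l =
    if odd l then 0 else (x * y) ^+ l./2 *+ 'C(l, l./2).
  rewrite exprDn coef_sum.
  have cf (j : 'I_l.+1) :
      (((x *: 'X^2) ^+ (l - j) * (y%:P) ^+ j) *+ 'C(l, j))`_l =
      if l == (l - j).*2 then x ^+ (l - j) * y ^+ j *+ 'C(l, j) else 0.
    rewrite coefMn exprZn -polyC_exp -exprM mulnC muln2.
    rewrite -scalerAl coefZ coefMC coefXn.
    by case: eqP; rewrite ?mul1r ?mulr1 ?mul0r ?mulr0 // mul0rn.
  rewrite (eq_bigr _ (fun j _ => cf j)) -big_mkcond /=.
  case: ifP => [odd_l | /negbT even_l].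
    rewrite big1 // => j /eqP El.
    by have := congr1 odd El; rewrite odd_double odd_l.
  have ltl : (l./2 < l.+1)%N by rewrite ltnS leq_half_double -addnn; lia.
  have El : l = l./2.*2 by rewrite -[LHS]odd_double_half (negPf even_l).
  have sub : (l - l./2 = l./2)%N by rewrite {1}El -addnn addnK.
  rewrite (big_pred1 (Ordinal ltl)) /= => [|j]; first by rewrite sub exprMn.
  have jl : (j <= l)%N by rewrite -ltnS.
  by apply/eqP/eqP => [E | ->]; [apply: val_inj => /=; lia | rewrite /=; lia].
apply: eq_bigr => i _; rewrite !coefMn !exprZn -!scalerAr !coefZ !coefMXn.
by case: ifP => // _; rewrite !diag ac.
Qed.

Lemma sum_root_unity (K : fieldType) (z : K) N :
  z ^+ N = 1 -> z != 1 -> \sum_(i < N) z ^+ i = 0.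
Proof.
move=> zN z1; apply: (mulfI (_ : z - 1 != 0)); first by rewrite subr_eq0.
by rewrite -subrX1 zN subrr mulr0.
Qed.

(** Exponents up to 2 n other than n differ from n by less than n + 1, so the
    average over the roots of unity annihilates them. *)
Lemma coef_root_unity_average (K : fieldType) (w : K) n (p : {poly K}) :
  n.+1.-primitive_root w -> (size p <= n.*2.+1)%N ->
  \sum_(i < n.+1) p.[w ^+ i] / (w ^+ i) ^+ n = n.+1%:R * p`_n.
Proof.
move=> w_prim szp.
have w0 : w != 0.
  apply/eqP=> w0; have := prim_expr_order w_prim.
  by rewrite w0 expr0n => /esym/eqP; rewrite oner_eq0.
have ltn2 : (n < n.*2.+1)%N by rewrite ltnS -addnn leq_addr.
under eq_bigr do rewrite (horner_coef_wide _ szp) mulr_suml.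
rewrite exchange_big /= (bigD1 (Ordinal ltn2)) //= [X in _ + X]big1 => [|j jn].
  rewrite addr0 (eq_bigr (fun=> p`_n)) => [|i _]; last first.
    by rewrite mulfK // !expf_neq0.
  by rewrite sumr_const card_ord mulr_natl.
rewrite (eq_bigr (fun i : 'I__ => p`_j * (w ^+ j / w ^+ n) ^+ i)) => [|i _].
  rewrite -mulr_sumr sum_root_unity ?mulr0 //.
    by rewrite expr_div_n -!exprM ![(_ * n.+1)%N]mulnC !exprM
      (prim_expr_order w_prim) !expr1n divr1.
  rewrite -subr_eq0 -(inj_eq (mulIf (expf_neq0 n w0))) mul0r mulrBl mul1r.
  rewrite divfK ?expf_neq0 // subr_eq0 (eq_prim_root_expr w_prim).
  have jn' : nat_of_ord j <> n by move=> E; case/eqP: jn; exact: val_inj.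
  have lj : (j <= n + n)%N by have := ltn_ord j; lia.
  apply/negP => /eqP; rewrite [(n %% _)%N]modn_small //.
  case: (ltngtP j n) jn' => // [ltj | gtj] _.
    by rewrite modn_small ?(ltn_trans ltj) // => E; rewrite E ltnn in ltj.
  have -> : nat_of_ord j = (j - n.+1 + n.+1)%N by lia.
  by rewrite modnDr modn_small; lia.
by rewrite expr_div_n -!exprM ![(i * _)%N]mulnC mulrA.
Qed.

Lemma prim_root_exists (K : closedFieldType) n :
  n.+1%:R != 0 :> K -> exists z : K, n.+1.-primitive_root z.
Proof.
move=> n_neq0; pose p : {poly K} := 'X^(n.+1) - 1.
have [r Dp] := closed_field_poly_normal p.
rewrite (monicP _) ?monicXnsubC // scale1r in Dp.
have rn1 : all n.+1.-unity_root r.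
  by apply/allP => z; rewrite -root_prod_XsubC -Dp.
have sz_r : (n.+1 < (size r).+1)%N.
  by rewrite -(size_prod_XsubC r id) -Dp size_XnsubC.
suff Ur : uniq r by have /hasP[z] := has_prim_root (ltn0Sn n) rn1 Ur sz_r;
  exists z.
by rewrite -separable_prod_XsubC -Dp separable_Xn_sub_1.
Qed.

Section SolidHarmonics.
Variable R : realType.
Local Notation C := (complex R).
Local Notation "x %:C" := (real_complex R x).
Local Notation re := (@complex.Re R).
Local Notation im := (@complex.Im R).
Implicit Types (v : 'rV[R]_3) (w : C).

Lemma enorm_sqr v :
  enorm v ^+ 2 = v 0 coord_x ^+ 2 + v 0 coord_y ^+ 2 + v 0 coord_z ^+ 2.
Proof.
rewrite sqr_sqrtr; last by apply: sumr_ge0 => i _; exact: sqr_ge0.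
rewrite !big_ord_recl big_ord0 addr0 addrA; congr (_ ^+ _ + _ ^+ _ + _ ^+ _);
  by congr (v _ _); apply: val_inj; rewrite /= inordK.
Qed.

Lemma enorm_ge0 v : 0 <= enorm v.
Proof. exact: sqrtr_ge0. Qed.

(** The linear forms z + i (x sin(phi) + y cos(phi)) of Laplace's integral for
    the Legendre polynomials, with w = exp(i phi). *)
Definition laplace_form w v : C :=
  Complex (v 0 coord_z) (v 0 coord_x * im w + v 0 coord_y * re w).

Lemma laplace_formD w v v' :
  laplace_form w (v + v') = laplace_form w v + laplace_form w v'.
Proof.
by rewrite /laplace_form !mxE; congr Complex; ring.
Qed.

Lemma laplace_formZ w c v : laplace_form w (c *: v) = c%:C * laplace_form w v.
Proof.
apply/eqP; rewrite eq_complex /= !mxE.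
by apply/andP; split; apply/eqP; ring.
Qed.

Lemma norm_laplace_form w v : `|w| = 1 -> `|laplace_form w v| <= (enorm v)%:C.
Proof.
move=> w1; rewrite normc_def lecR -ler_sqr ?nnegrE ?sqrtr_ge0 ?enorm_ge0 //.
rewrite enorm_sqr sqr_sqrtr /=; last by rewrite addr_ge0 ?sqr_ge0.
have : (re w ^+ 2 + im w ^+ 2)%:C = 1 by rewrite add_Re2_Im2 w1 expr1n.
move=> /(congr1 re) /= E.
have := sqr_ge0 (v 0 coord_x * re w - v 0 coord_y * im w).
have -> : (v 0 coord_x * re w - v 0 coord_y * im w) ^+ 2 =
  (v 0 coord_x ^+ 2 + v 0 coord_y ^+ 2) * (re w ^+ 2 + im w ^+ 2) -
  (v 0 coord_x * im w + v 0 coord_y * re w) ^+ 2 by ring.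
by rewrite E mulr1; lra.
Qed.

(** Laplace's formula with the integral over the circle replaced by an average
    over roots of unity, which is exact for trigonometric polynomials of degree
    less than their number. *)
Lemma solid_harmonic_average n (w : C) v : n.+1.-primitive_root w ->
  enorm v != 0 ->
  (enorm v ^+ n * (legendre R n).[v 0 coord_z / enorm v])%:C =
  n.+1%:R^-1 * \sum_(i < n.+1) laplace_form (w ^+ i) v ^+ n.
Proof.
move=> w_prim v0; set r := enorm v; set u := _ / r.
pose x := v 0 coord_x; pose y := v 0 coord_y; pose z := v 0 coord_z.
have zE : z = r * u by rewrite /u mulrC divfK.
have t0 : 2 ^+ n != 0 :> R by rewrite expf_neq0.
have two0 : 2 != 0 :> C by rewrite pnatr_eq0.
pose al : C := Complex x y; pose be : C := Complex x (- y).
have r2 : r ^+ 2 = x ^+ 2 + y ^+ 2 + z ^+ 2 by exact: enorm_sqr.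
have abE : al * be = (r ^+ 2 - z ^+ 2)%:C.
  by apply/eqP; rewrite eq_complex r2 /=; apply/andP; split; apply/eqP; ring.
pose p : {poly C} := (al / 2) *: 'X^2 + z%:C *: 'X + (- (be / 2))%:P.
have pE : (p ^+ n)`_n = (r ^+ n * (legendre R n).[u])%:C.
  pose q : {poly R} := (r / 2) *: 'X^2 + z *: 'X + (r * (u ^+ 2 - 1) / 2)%:P.
  have qE : q = (r / 2) *: ('X^2 + (2 * u) *: 'X + (u ^+ 2 - 1)%:P).
    rewrite /q !scalerDr scalerA zE -[_ / 2 *: _%:P]mul_polyC -polyCM.
    by congr (_ + _ *: _ + _%:P); field.
  have -> : r ^+ n * (legendre R n).[u] = (q ^+ n)`_n.
    rewrite qE exprZn coefZ -legendre_coef expr_div_n.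
    by rewrite mulrA divfK.
  rewrite -coef_map rmorphXn /= /q 2!rmorphD /= !map_polyZ /= map_polyXn.
  rewrite map_polyX map_polyC /=; apply: middle_coef_trinomial.
  rewrite mulrN mulrACA abE -invfM.
  rewrite -(rmorphM (real_complex R)) -(rmorph_nat (real_complex R) 2).
  rewrite -(rmorphM (real_complex R)) -fmorphV -rmorphM -rmorphN.
  by congr (_%:C); rewrite zE; field.
rewrite -pE; have szp : (size (p ^+ n)%R <= n.*2.+1)%N.
  have szp : (size p <= 3)%N.
    rewrite (leq_trans (size_polyD _ _)) // geq_max.
    rewrite (leq_trans (size_polyD _ _)) ?geq_max /=.
      exact: leq_trans (size_polyC_leq1 _) _.
    by rewrite !(leq_trans (size_scale_leq _ _)) // ?size_polyXn ?size_polyX.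
  apply: leq_trans (size_poly_exp_leq p n) _; rewrite ltnS -mul2n leq_mul2r.
  by apply/orP; right; move: (szp); lia.
have N0 : n.+1%:R != 0 :> C by rewrite pnatr_eq0.
apply: (mulfI N0); rewrite mulVKf // -(coef_root_unity_average w_prim szp).
apply: eq_bigr => i _; rewrite horner_exp -expr_div_n; congr (_ ^+ n).
set t := w ^+ i.
have t1 : `|t| = 1.
  have tn : t ^+ n.+1 = 1.
    by rewrite -exprM mulnC exprM (prim_expr_order w_prim) expr1n.
  by apply/eqP; rewrite -(@pexpr_eq1 _ _ n.+1) // -normrX tn normr1.
have t0' : t != 0 by rewrite -normr_eq0 t1 oner_eq0.
have tV : t^-1 = conjc t by rewrite invc_norm t1 expr1n invr1 mul1r.
rewrite /p !hornerE /= !mulrDl.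
rewrite !mulfK // tV.
rewrite -(rmorph_nat (real_complex R) 2) -fmorphV.
case: (t) => a b; apply/eqP; rewrite eq_complex /=.
by apply/andP; split; apply/eqP; rewrite /x /y /z /=; field.
Qed.

Let re_sum (I : Type) (r : seq I) (F : I -> C) :
  re (\sum_(i <- r) F i) = \sum_(i <- r) re (F i).
Proof. by elim/big_rec2: _ => // i _ z _ <-; case: (F i); case: z. Qed.

(** Along a line each Laplace form is affine with coefficients bounded by the
    Euclidean norms, so the solid harmonic is a polynomial whose coefficient
    norm carries no numerical factor growing with the degree. *)
Lemma solid_harmonic_line n v e c :
  exists q : {poly R}, coef_norm q <= (enorm v + `|c| * enorm e) ^+ n /\
    forall s, enorm (v + (c * s) *: e) != 0 ->
      q.[s] = enorm (v + (c * s) *: e) ^+ n *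
        (legendre R n).[(v + (c * s) *: e) 0 coord_z /
                        enorm (v + (c * s) *: e)].
Proof.
have N0 : n.+1%:R != 0 :> C by rewrite pnatr_eq0.
have [w w_prim] := prim_root_exists N0.
pose L i : {poly C} := (laplace_form (w ^+ i) v)%:P +
  (c%:C * laplace_form (w ^+ i) e) *: 'X.
pose Q : {poly C} := n.+1%:R^-1 *: \sum_(i < n.+1) L i ^+ n.
have normQ : coef_norm Q <= ((enorm v + `|c| * enorm e) ^+ n)%:C.
  rewrite coef_normZ normfV normr_nat ler_pdivrMl ?ltr0n //.
  apply: le_trans (coef_norm_sum _ _ _) _.
  rewrite -[n.+1 in X in _ <= X]card_ord mulr_natl -sumr_const.
  apply: ler_sum => i _; apply: le_trans (coef_normX _ _) _.
  rewrite rmorphXn lerXn2r ?nnegrE ?coef_norm_ge0 //.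
    by rewrite ler0c addr_ge0 ?mulr_ge0 ?enorm_ge0.
  have w1 : `|w ^+ i| = 1.
    apply/eqP; rewrite -(@pexpr_eq1 _ _ n.+1) // -normrX -exprM mulnC exprM.
    by rewrite (prim_expr_order w_prim) expr1n normr1.
  rewrite coef_norm_linear rmorphD rmorphM /= lerD ?norm_laplace_form //.
  rewrite normrM ler_pM ?norm_laplace_form // normc_def /= expr0n addr0.
  by rewrite sqrtr_sqr.
pose q : {poly R} := \poly_(i < size Q) re Q`_i.
exists q; split.
  rewrite -lecR; apply: le_trans normQ; rewrite (@coef_norm_widen _ (size Q)).
    rewrite rmorph_sum; apply: ler_sum => i _; rewrite coef_poly ltn_ord.
    exact: normc_ge_Re.
  exact: size_poly.
move=> s r0; apply: complexI; rewrite (solid_harmonic_average w_prim r0).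
have -> : q.[s] = re Q.[s%:C].
  rewrite (horner_coef_wide _ (size_poly _ _)) horner_coef re_sum.
  apply: eq_bigr => i _; rewrite coef_poly ltn_ord -rmorphXn.
  by case: (Q`_i) => a b /=; rewrite mulr0 subr0.
have -> : Q.[s%:C] =
    n.+1%:R^-1 * \sum_(i < n.+1) laplace_form (w ^+ i) (v + (c * s) *: e) ^+ n.
  rewrite /Q hornerZ horner_sum; congr (_ * _); apply: eq_bigr => i _.
  rewrite horner_exp laplace_formD laplace_formZ /L !hornerE rmorphM /=.
  by congr (_ ^+ n); ring.
by rewrite -(solid_harmonic_average w_prim r0).
Qed.

End SolidHarmonics.

(** * Taylor expansion in one variable *)

Section Taylor.
Variable R : realType.

Definition taylor_poly m (D : nat -> R -> R) : {poly R} :=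
  \poly_(j < m) (D j 0 / j`!%:R).

Lemma deriv_taylor_poly m D :
  (taylor_poly m.+1 D)^`() = taylor_poly m (fun j => D j.+1).
Proof.
apply/polyP => i; rewrite coef_deriv !coef_poly ltnS; case: ifP => _.
  rewrite -[LHS]mulr_natr factS natrM invfM -!mulrA [_^-1 * _%:R]mulrC.
  by rewrite mulKf ?pnatr_eq0.
by rewrite mul0rn.
Qed.

(** The derivative of the remainder is the remainder of the shifted family, so
    the mean value theorem drives an induction on the order. *)
Lemma taylor_remainder_right m (D : nat -> R -> R) (h M : R) : 0 <= h ->
  (forall j (t : R), (j < m)%N -> 0 <= t <= h ->
    is_derive t 1 (D j) (D j.+1 t)) ->
  (forall t : R, 0 <= t <= h -> `|D m t| <= M) ->
  `|D 0%N h - (taylor_poly m D).[h]| <= M * h ^+ m.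
Proof.
elim: m D h => [|m IHm] D h h0 dD DM.
  rewrite /taylor_poly poly_def big_ord0 horner0 subr0 expr0 mulr1.
  by apply: DM; rewrite h0 lexx.
pose g t := D 0%N t - (taylor_poly m.+1 D).[t].
pose g' t := D 1%N t - (taylor_poly m (fun j => D j.+1)).[t].
have dg t : 0 <= t <= h -> is_derive t 1 g (g' t).
  move=> th; rewrite /g'; have dD0 := dD 0%N t isT th.
  by rewrite -deriv_taylor_poly; apply: is_deriveB.
have [||c ch gE] := @MVT_segment R g g' 0 h h0.
- by move=> t; rewrite in_itv /= => /andP[/ltW t0 /ltW th]; apply: dg;
  rewrite t0.
- apply: derivable_within_continuous => t; rewrite in_itv /= => th.
  by have [] := dg t th.
have g00 : g 0 = 0.
  by rewrite /g horner_coef0 coef_poly /= fact0 divr1 subrr.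
rewrite in_itv /= in ch; have [c0 ch'] := andP ch.
have : `|g' c| <= M * c ^+ m.
  apply: IHm => // [j t jm /andP[t0 tc] | t /andP[t0 tc]].
    by apply: dD; rewrite // t0 (le_trans tc).
  by apply: DM; rewrite // t0 (le_trans tc).
move: gE; rewrite g00 subr0 -/(g h) => ->; rewrite subr0 normrM (ger0_norm h0)
  => gc.
rewrite exprSr mulrA ler_wpM2r //; apply: le_trans gc _.
have M0 : 0 <= M by apply: le_trans (DM 0 _); rewrite ?lexx ?h0.
by rewrite ler_wpM2l // lerXn2r ?nnegrE.
Qed.

Lemma taylor_remainder m (D : nat -> R -> R) (rho u M : R) : `|u| <= rho ->
  (forall j (t : R), (j < m)%N -> `|t| <= rho ->
    is_derive t 1 (D j) (D j.+1 t)) ->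
  (forall t : R, `|t| <= rho -> `|D m t| <= M) ->
  `|D 0%N u - (taylor_poly m D).[u]| <= M * `|u| ^+ m.
Proof.
move=> urho dD DM; have [u0|u0] := leP 0 u.
  rewrite ger0_norm // in urho *; apply: taylor_remainder_right => //.
    move=> j t jm /andP[t0 tu]; apply: dD => //.
    by rewrite ger0_norm // (le_trans tu).
  by move=> t /andP[t0 tu]; apply: DM; rewrite ger0_norm // (le_trans tu).
pose D' j t := (-1) ^+ j * D j (- t).
have -> : D 0%N u = D' 0%N (- u) by rewrite /D' expr0 mul1r opprK.
have -> : (taylor_poly m D).[u] = (taylor_poly m D').[- u].
  rewrite /taylor_poly !horner_poly; apply: eq_bigr => i _.
  rewrite /D' oppr0 -[X in _ = _ * X ^+ _]mulN1r exprMn.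
  transitivity (((-1) ^+ i) ^+ 2 * (D i 0 / i`!%:R * u ^+ i)).
    by rewrite sqrr_sign mul1r.
  by rewrite expr2 -!mulrA; congr (_ * _); rewrite mulrCA; congr (_ * _);
    rewrite mulrCA.
rewrite ltr0_norm // in urho *; apply: taylor_remainder_right => //.
- by rewrite oppr_ge0 ltW.
- move=> j t jm /andP[t0 tu].
  have dDj : is_derive (- t) 1 (D j) (D j.+1 (- t)).
    by apply: dD; rewrite // normrN ger0_norm // (le_trans tu).
  have dN : is_derive t 1 (fun x : R => - x) (- 1) by apply: is_deriveNid.
  have dc := is_derive1_comp dDj dN.
  have -> : D' j.+1 t = (-1) ^+ j *: (-1 *: D j.+1 (- t)).
    by rewrite /D' exprSr /GRing.scale /= mulrA.
  rewrite (_ : D' j = (-1) ^+ j \*: (D j \o (fun x : R => - x))) //.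
  apply: is_deriveZ.
  by move: dc; rewrite /GRing.scale /= mulrC.
- move=> t /andP[t0 tu]; rewrite /D' normrM normrX normrN1 expr1n mul1r.
  by apply: DM; rewrite normrN ger0_norm // (le_trans tu).
Qed.

End Taylor.

(** * Families with uniform expansions *)

Section Jets.
Variables (R : realType) (m : nat) (T : Type) (P : set T).
Implicit Types (F G : T -> R -> R) (c : T -> R).

(** A family of functions on [0, 1] that agree up to O(s^m) with polynomials,
    the implied constant and the coefficient norms being uniform over the
    parameters in P.  The degrees are left free, so that products need no
    truncation and solid harmonics of every degree qualify. *)
Definition jet F := exists C : R, forall t, P t ->
  exists2 p : {poly R}, coef_norm p <= C &
    forall s : R, 0 <= s <= 1 -> `|F t s - p.[s]| <= C * s ^+ m.

Definition jbounded F := exists C : R, forall t, P t ->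
  forall s : R, 0 <= s <= 1 -> `|F t s| <= C.

Definition jsmall k F := exists C : R, forall t, P t ->
  forall s : R, 0 <= s <= 1 -> `|F t s| <= C * s ^+ k.

Let itv_exp (s : R) k : 0 <= s <= 1 -> 0 <= s ^+ k <= 1.
Proof. by move=> /andP[s0 s1]; rewrite exprn_ge0 // exprn_ile1. Qed.

Let itv_norm (s : R) : 0 <= s <= 1 -> `|s| <= 1.
Proof. by move=> /andP[s0 s1]; rewrite ger0_norm. Qed.

(** Constants can be taken nonnegative even when P is empty. *)
Let wlog_ge0 (Q : R -> Prop) : (forall C D, C <= D -> Q C -> Q D) ->
  (exists C, Q C) -> exists2 C, 0 <= C & Q C.
Proof.
move=> mono [C QC]; exists (Num.max C 0); rewrite ?le_max ?lexx ?orbT //.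
by apply: mono QC; rewrite le_max lexx.
Qed.

Let jetW C D F : C <= D -> (forall t, P t ->
    exists2 p : {poly R}, coef_norm p <= C &
      forall s : R, 0 <= s <= 1 -> `|F t s - p.[s]| <= C * s ^+ m) ->
  forall t, P t -> exists2 p : {poly R}, coef_norm p <= D &
      forall s : R, 0 <= s <= 1 -> `|F t s - p.[s]| <= D * s ^+ m.
Proof.
move=> CD FC t Pt; have [p np Fp] := FC t Pt.
exists p => [|s s01]; first exact: le_trans CD.
by apply: le_trans (Fp s s01) _; rewrite ler_wpM2r //;
  case/andP: (itv_exp m s01).
Qed.

Let jet_ge0 F : jet F -> exists2 C : R, 0 <= C & forall t, P t ->
  exists2 p : {poly R}, coef_norm p <= C &
    forall s : R, 0 <= s <= 1 -> `|F t s - p.[s]| <= C * s ^+ m.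
Proof. by apply: wlog_ge0 => C D CD; exact: jetW. Qed.

Lemma eq_jet F G : (forall t (s : R), P t -> 0 <= s <= 1 -> F t s = G t s) ->
  jet F -> jet G.
Proof.
move=> FG [C FC]; exists C => t Pt; have [p np Fp] := FC t Pt.
by exists p => // s s01; rewrite -FG // Fp.
Qed.

Lemma jet_poly (p : T -> {poly R}) C : (forall t, P t -> coef_norm (p t) <=
  C) ->
  jet (fun t s => (p t).[s]).
Proof.
move=> pC; exists C => t Pt; exists (p t); first exact: pC.
move=> s s01; rewrite subrr normr0 mulr_ge0 //.
  exact: le_trans (coef_norm_ge0 _) (pC t Pt).
by case/andP: (itv_exp m s01).
Qed.

Lemma jet_cst c C : (forall t, P t -> `|c t| <= C) -> jet (fun t _ => c t).
Proof.
move=> cC; apply: (@eq_jet (fun t s => ((c t)%:P).[s])) => [t s|].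
  by rewrite hornerC.
by apply: (@jet_poly _ C) => t Pt; rewrite coef_normC cC.
Qed.

Lemma jsmall_jet F : jsmall m F -> jet F.
Proof.
move=> /wlog_ge0[C D CD FC t Pt s s01|C C0 FC].
  apply: le_trans (FC t Pt s s01) _; rewrite ler_wpM2r //.
  by case/andP: (itv_exp m s01).
exists C => t Pt; exists 0 => [|s s01]; first by rewrite coef_norm0.
by rewrite horner0 subr0 FC.
Qed.

Lemma jetD F G : jet F -> jet G -> jet (fun t s => F t s + G t s).
Proof.
move=> [C FC] [D GD]; exists (C + D) => t Pt.
have [p np Fp] := FC t Pt; have [q nq Gq] := GD t Pt.
exists (p + q) => [|s s01]; first exact: le_trans (coef_normD _ _) (lerD _ _).
by rewrite hornerD opprD addrACA mulrDl (le_trans (ler_normD _ _)) ?lerD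
  ?Fp ?Gq.
Qed.

Lemma jet_bounded F : jet F -> jbounded F.
Proof.
move=> /jet_ge0[C C0 FC]; exists (C + C) => t Pt s s01.
have [p np Fp] := FC t Pt; rewrite -(subrK p.[s] (F t s)).
apply: le_trans (ler_normD _ _) (lerD _ _).
  apply: le_trans (Fp s s01) _; rewrite ler_piMr //.
  by case/andP: (itv_exp m s01).
exact: le_trans (horner_coef_norm _ (itv_norm s01)) np.
Qed.

Lemma jetM F G : jet F -> jet G -> jet (fun t s => F t s * G t s).
Proof.
move=> jF jG; have [B FB] := jet_bounded jF.
have [C C0 FC] := jet_ge0 jF; have [D D0 GD] := jet_ge0 jG.
have [B0 B00 BB] : exists2 B0 : R, 0 <= B0 & forall t, P t ->
    forall s : R, 0 <= s <= 1 -> `|F t s| <= B0.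
  exists (Num.max B 0) => [|t Pt s s01]; first by rewrite le_max lexx orbT.
  by rewrite le_max FB.
exists (C * D + B0 * D) => t Pt.
have [p np Fp] := FC t Pt; have [p2 nq Gq] := GD t Pt.
exists (p * p2) => [|s s01].
  apply: le_trans (coef_normM _ _) _; rewrite -[X in X <= _]addr0 lerD //.
    by rewrite ler_pM ?coef_norm_ge0.
  by rewrite mulr_ge0.
have -> : F t s * G t s - (p * p2).[s] =
    (F t s - p.[s]) * p2.[s] + F t s * (G t s - p2.[s]) by rewrite hornerM;
      ring.
rewrite [leRHS]mulrDl; apply: le_trans (ler_normD _ _) (lerD _ _);
  rewrite normrM.
  rewrite mulrAC ler_pM ?Fp //.
  exact: le_trans (horner_coef_norm _ (itv_norm s01)) nq.
by rewrite -mulrA; apply: ler_pM => //; [exact: BB | exact: Gq].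
Qed.

Lemma jetX F k : jet F -> jet (fun t s => F t s ^+ k).
Proof.
move=> jF; elim: k => [|k IHk].
  by apply: (@jet_cst (fun=> 1) 1) => t _; rewrite normr1.
by apply: eq_jet (jetM jF IHk) => t s _ _; rewrite exprS.
Qed.

Lemma jet_sum k (F : nat -> T -> R -> R) : (forall j, (j < k)%N -> jet (F j)) ->
  jet (fun t s => \sum_(j < k) F j t s).
Proof.
elim: k => [|k IHk] jF.
  apply: (@eq_jet (fun _ _ => 0)) => [t s _ _|]; first by rewrite big_ord0.
  by apply: (@jet_cst (fun=> 0) 0) => t _; rewrite normr0.
have jFk := jF k (ltnSn k); have jFs := IHk (fun j jk => jF j (ltnW jk)).
by apply: eq_jet (jetD jFs jFk) => t s _ _; rewrite big_ord_recr.
Qed.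

Lemma jet_increment F : (0 < m)%N -> jet F -> jsmall 1 (fun t s =>
  F t s - F t 0).
Proof.
move=> m0 /jet_ge0[C C0 FC]; exists (C + C) => t Pt s s01.
have [p np Fp] := FC t Pt; have [s0 s1] := andP s01.
have Fp0 : F t 0 = p.[0].
  apply/eqP; rewrite -subr_eq0 -normr_le0.
  have := Fp 0; rewrite lexx ler01 => /(_ isT).
  by rewrite expr0n eqn0Ngt m0 mulr0.
rewrite Fp0 -(subrK p.[s] (F t s)) -addrA expr1 mulrDl.
apply: le_trans (ler_normD _ _) (lerD _ _).
  apply: le_trans (Fp s s01) _; rewrite ler_wpM2l //.
  by rewrite -(prednK m0) exprS ler_piMr // exprn_ile1.
have := @horner_take_poly _ 1 p s (itv_norm s01).
have -> : (take_poly 1 p).[s] = p.[0].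
  by rewrite horner_poly big_ord1 expr0 mulr1 horner_coef0.
rewrite ger0_norm // expr1 => h; apply: le_trans h _.
by rewrite ler_wpM2r.
Qed.

(** D t j stands for the j-th derivative of the outer function; replacing the
    latter by its Taylor polynomial at 0 costs O(th^m) = O(s^m). *)
Lemma jet_comp (D : T -> nat -> R -> R) (th : T -> R -> R) (rho C : R) :
  (0 < m)%N -> jet th -> jsmall 1 th ->
  (forall t (s : R), P t -> 0 <= s <= 1 -> `|th t s| <= rho) ->
  (forall t j (u : R), P t -> (j < m)%N -> `|u| <= rho ->
     is_derive u 1 (D t j) (D t j.+1 u)) ->
  (forall t j (u : R), P t -> (j <= m)%N -> `|u| <= rho -> `|D t j u| <= C) ->
  jet (fun t s => D t 0%N (th t s)).
Proof.
move=> m0 jth [B thB] thrho dD DC.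
have rem : jsmall m (fun t s => D t 0%N (th t s) -
    (taylor_poly m (D t)).[th t s]).
  exists (C * B ^+ m) => t Pt s s01.
  have C0 : 0 <= C.
    by apply: le_trans (DC t 0%N (th t s) Pt _ (thrho t s Pt s01)).
  have := @taylor_remainder _ m (D t) rho (th t s) C (thrho t s Pt s01)
    (fun j u jm urho => dD t j u Pt jm urho)
    (fun u urho => DC t m u Pt (leqnn m) urho).
  move=> h; apply: le_trans h _; rewrite -mulrA ler_wpM2l // -exprMn.
  by rewrite lerXn2r ?nnegrE ?(le_trans _ (thB t Pt s s01)) // -[s]expr1 thB.
apply: (@eq_jet (fun t s => (D t 0%N (th t s) - (taylor_poly m (D t)).[th t s])
  +
    \sum_(j < m) (D t j 0 / j`!%:R) * th t s ^+ j)) => [t s _ _|].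
  by rewrite /taylor_poly horner_poly subrK.
apply: jetD (jsmall_jet rem) _.
apply: (@jet_sum m (fun j t s => (D t j 0 / j`!%:R) * th t s ^+ j)) => j jm.
apply: jetM _ (jetX _ jth); apply: (@jet_cst _ C) => t Pt.
rewrite normrM normfV normr_nat ler_pdivrMr ?ltr0n ?fact_gt0 //.
have [rho0|rho0] := leP 0 rho; last first.
  have := le_lt_trans (thrho t 0 Pt _) rho0.
  by rewrite lexx ler01 => /(_ isT); rewrite normr_lt0.
have DC0 : `|D t j 0| <= C by apply: DC; rewrite ?normr0 // ltnW.
apply: (le_trans DC0); rewrite ler_peMr ?ler1n ?fact_gt0 //.
exact: le_trans (normr_ge0 _) DC0.
Qed.

End Jets.

Section JetFunctions.
Variables (R : realType) (m : nat) (T : Type) (P : set T).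
Hypothesis m_gt0 : (0 < m)%N.

Lemma jet_expR (F : T -> R -> R) : jet m P F -> jet m P (fun t s =>
  expR (F t s)).
Proof.
move=> jF; have [B FB] := jet_bounded jF.
have inc := jet_increment m_gt0 jF.
have jinc : jet m P (fun t s => F t s - F t 0).
  apply: jetD jF _; apply: (@jet_cst _ _ _ _ _ B) => t Pt.
  by rewrite normrN FB // lexx ler01.
apply: (@eq_jet _ _ _ _ (fun t s => expR (F t 0 + (F t s - F t 0)))) =>
  [t s _ _|].
  by rewrite addrC subrK.
apply: (@jet_comp _ _ _ _ (fun t _ u => expR (F t 0 + u)) _ (B + B)
  (expR (B + (B + B))) m_gt0 jinc inc).
- move=> t s Pt s01; apply: le_trans (ler_normB _ _) (lerD _ _);
  apply: FB => //.
  by rewrite lexx ler01.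
- move=> t j u Pt _ _.
  have := @is_derive1_comp R expR (fun u => F t 0 + u) u _ _
    (is_derive_expR _) (is_deriveD (is_derive_cst _ _ _) (is_derive_id _ _)).
  by rewrite add0r mulr1.
- move=> t j u Pt _ uB; rewrite ger0_norm ?expR_ge0 // ler_expR lerD //.
    by apply: le_trans (ler_norm _) _; apply: FB; rewrite // lexx ler01.
  exact: le_trans (ler_norm _) uB.
Qed.

Lemma norm_ln1D (x : R) : `|x| <= 1 / 2 -> `|ln (1 + x)| <= 2 * `|x|.
Proof.
move=> x12; have /andP[x1 x2] : - (1/2) <= x <= 1/2 by rewrite -ler_norml.
have lnle (y : R) : -1 < y -> ln (1 + y) <= y by exact: le_ln1Dx.
have x0 : 0 < 1 + x by lra.
rewrite ler_norml; apply/andP; split; last first.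
  apply: (le_trans (lnle x _)); first by lra.
  by have := ler_norm x; have := normr_ge0 x; lra.
have := lnle ((1 + x)^-1 - 1); rewrite [X in ln X]addrC subrK lnV ?posrE //.
have xV : 0 < (1 + x)^-1 by rewrite invr_gt0.
have -> : -1 < (1 + x)^-1 - 1 by lra.
move=> /(_ isT) lnx; rewrite lerNl; apply: le_trans lnx _.
have -> : (1 + x)^-1 - 1 = - x / (1 + x) by field; rewrite gt_eqF.
rewrite ler_pdivrMr //.
have nx : - x <= `|x| by rewrite -normrN ler_norm.
apply: le_trans nx _.
have : 0 <= `|x| * (1 + 2 * x) by rewrite mulr_ge0 //; lra.
by lra.
Qed.

(** The exponent may grow like n because the argument is 1 + O(1/n): each
    derivative in theta costs a factor of size exponent / n. *)
Lemma jet_powR (n : T -> nat) (a : T -> R) (th : T -> R -> R) (A : R) :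
  (forall t, P t -> (0 < n t)%N) -> 0 <= A ->
  (forall t, P t -> `|a t| <= A * (n t)%:R) ->
  jet m P th -> jsmall P 1 th ->
  (forall t (s : R), P t -> 0 <= s <= 1 -> `|th t s| <= 1 / 2) ->
  jet m P (fun t s => (1 + th t s / (n t)%:R) `^ a t).
Proof.
move=> n_gt0 A0 aA jth sth th12.
pose D t j (u : R) := (\prod_(i < j) ((a t - i%:R) / (n t)%:R)) *
  (1 + u / (n t)%:R) `^ (a t - j%:R).
apply: (@eq_jet _ _ _ _ (fun t s => D t 0%N (th t s))) => [t s _ _|].
  by rewrite /D big_ord0 mul1r subr0.
have small t (u : R) : P t -> `|u| <= 1 / 2 -> `|u / (n t)%:R| <=
  1 / 2 / (n t)%:R.
  by move=> Pt u12; rewrite normrM normfV normr_nat ler_pM2r //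
    invr_gt0 ltr0n n_gt0.
have half t (u : R) : P t -> `|u| <= 1 / 2 -> `|u / (n t)%:R| <= 1 / 2.
  move=> Pt u12; apply: le_trans (small t u Pt u12) _.
  by rewrite ler_pdivrMr ?ltr0n ?n_gt0 // ler_peMr ?ler1n ?n_gt0 //; lra.
have pos t (u : R) : P t -> `|u| <= 1 / 2 -> 0 < 1 + u / (n t)%:R.
  move=> Pt /(half t u Pt); rewrite ler_norml => /andP[]; lra.
apply: (@jet_comp _ _ _ _ D th (1 / 2)
  ((A + m%:R + 1) ^+ m * expR (A + m%:R)) m_gt0 jth sth th12).
- move=> t j u Pt _ u12.
  have d1 : is_derive (1 + u / (n t)%:R) 1 (fun x => x `^ (a t - j%:R)) _ :=
    is_derive1_powR _ (pos t u Pt u12).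
  have d2 : is_derive u 1 (fun u : R => 1 + u / (n t)%:R) (n t)%:R^-1.
    rewrite (_ : (fun _ => _) = cst 1 + ((n t)%:R^-1 \*: (@id R))); last first.
      apply/funext => v /=; rewrite [v / _]mulrC; reflexivity.
    have dc : is_derive u (1 : R) (cst (1 : R)) (0 : R) by exact: is_derive_cst.
    have di : is_derive u (1 : R) (@id R) (1 : R) by exact: is_derive_id.
    have := is_deriveD dc (is_deriveZ (n t)%:R^-1 di).
    by rewrite add0r /GRing.scale /= mulr1.
  have dD := is_deriveZ (\prod_(i < j) ((a t - i%:R) / (n t)%:R))
    (@is_derive1_comp R (fun x => x `^ (a t - j%:R))
      (fun u => 1 + u / (n t)%:R) u _ _ d1 d2).
  apply: (is_derive_eq dD); rewrite /D big_ord_recr /= /GRing.scale /=.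
  have -> : a t - j.+1%:R = a t - j%:R - 1 by rewrite -natr1; ring.
  set pr := \prod_(_ < _) _; set w := _ `^ _; ring.
- move=> t j u Pt jm u12; rewrite /D normrM.
  have n0 : 0 < (n t)%:R :> R by rewrite ltr0n n_gt0.
  have n1 : 1 <= (n t)%:R :> R by rewrite ler1n n_gt0.
  have m0 : 0 <= m%:R :> R by rewrite ler0n.
  have aj i : (i <= m)%N -> `|a t - i%:R| <= (A + m%:R) * (n t)%:R.
    move=> im; apply: le_trans (ler_normB _ _) _.
    rewrite mulrDl lerD ?aA // normr_nat.
    by rewrite (le_trans (_ : i%:R <= m%:R)) ?ler_nat // ler_peMr.
  apply: ler_pM => //.
    rewrite normr_prod.
    apply: (@le_trans _ _ (\prod_(i < j) (A + m%:R + 1))).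
      apply: ler_prod => i _; rewrite normr_ge0 /= normrM normfV (gtr0_norm n0).
      rewrite ler_pdivrMr //; apply: le_trans (aj i _) _.
        by rewrite ltnW // (leq_trans (ltn_ord i)).
      by rewrite ler_pM2r //; lra.
    rewrite prodr_const card_ord ler_weXn2l //; lra.
  rewrite /powR gt_eqF ?pos // ger0_norm ?expR_ge0 // ler_expR.
  apply: le_trans (ler_norm _) _; rewrite normrM.
  apply: (@le_trans _ _ ((A + m%:R) * (n t)%:R * (2 * (1 / 2 / (n t)%:R)))).
    apply: ler_pM; rewrite ?aj //.
    apply: le_trans (norm_ln1D (half t u Pt u12)) _.
    by rewrite ler_pM2l // small.
  by rewrite mul1r [2 * _]mulrA mulfV ?mul1r ?pnatr_eq0 // mulfK // gt_eqF.
Qed.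

End JetFunctions.

(** * Regularity of the coefficient along segments *)

Section UnitIntegral.
Variable R : realType.
Implicit Types (f g : R -> R).

Definition unit_integral f := Rintegral (@lebesgue_measure R) `[0, 1] f.

Let integrable01 f : {within `[0, 1], continuous f} ->
  (@lebesgue_measure R).-integrable `[0, 1] (EFin \o f).
Proof.
by move=> cf; apply: continuous_compact_integrable => //;
  exact: segment_compact.
Qed.

Lemma unit_integralB f g : {within `[0, 1], continuous f} ->
  {within `[0, 1], continuous g} ->
  unit_integral (fun s => f s - g s) = unit_integral f - unit_integral g.
Proof. by move=> cf cg; apply: RintegralB => //; exact: integrable01. Qed.

Lemma unit_integral_cst (c : R) : unit_integral (fun=> c) = c.
Proof.
rewrite /unit_integral Rintegral_cst //= lebesgue_measure_itv /= lte_fin ltr01.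
by rewrite /= subr0 mulr1.
Qed.

Lemma norm_unit_integral f (M : R) : {within `[0, 1], continuous f} ->
  (forall s, 0 <= s <= 1 -> `|f s| <= M) -> `|unit_integral f| <= M.
Proof.
move=> cf fM; apply: le_trans (le_normr_Rintegral _ (integrable01 cf)) _ => //.
rewrite -[X in _ <= X]unit_integral_cst; apply: le_Rintegral => //.
- apply: (@integrable01 (fun s => `|f s|)).
  by move=> s; apply: cvg_norm; exact: cf.
- by apply: (@integrable01 (fun=> M)) => s; exact: cvg_cst.
Qed.

Lemma unit_integral_sum m (f : nat -> R -> R) (c : nat -> R) :
  (forall j, (j < m)%N -> {within `[0, 1], continuous f j}) ->
  {within `[0, 1], continuous (fun s => \sum_(j < m) f j s * c j)} /\
  unit_integral (fun s => \sum_(j < m) f j s * c j) =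
  \sum_(j < m) unit_integral (f j) * c j.
Proof.
elim: m => [|m IHm] cf.
  have -> : (fun s : R => \sum_(j < 0) f j s * c j) = fun=> 0.
    by apply/funext => s; rewrite big_ord0.
  rewrite big_ord0; by split; [move=> s; exact: cvg_cst | exact:
    unit_integral_cst].
have [cS iS] := IHm (fun j jm => cf j (ltnW jm)).
have cm : {within `[0, 1], continuous (fun s => f m s * c m)}.
  by move=> s; apply: cvgM; [exact: cf | exact: cvg_cst].
have -> : (fun s : R => \sum_(j < m.+1) f j s * c j) =
    fun s => \sum_(j < m) f j s * c j + f m s * c m.
  by apply/funext => s; rewrite big_ord_recr.
rewrite big_ord_recr /=; split; first by move=> s; apply: cvgD;
  [exact: cS | exact: cm].
rewrite /unit_integral RintegralD //; [|exact: integrable01..].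
rewrite -/(unit_integral _) iS; congr (_ + _).
by apply: RintegralZr => //; apply: integrable01; exact: cf.
Qed.

End UnitIntegral.

Section ClassCk.
Variable R : realType.
Local Notation V := 'rV[R]_3.
Variables (Omega : set V) (m : nat) (sigma : V -> R).
Hypotheses (Omega_open : open Omega) (Omega_bounded : bounded_set Omega).
Hypothesis sigma_Ck : Ck_closure m Omega sigma.

Lemma Ck_continuous s x : (size s <= m)%N -> Omega x ->
  {for x, continuous (iter_partial s sigma)}.
Proof.
move=> sm Ox; have [_ _ /(_ s sm)[g [cg gE]]] := sigma_Ck.
have nO : \forall z \near x, Omega z by exact: open_nbhs_nbhs.
have gx : g @ x --> g x.
  move/subspace_continuousP : cg => /(_ x (subset_closure Ox)) cg U nU.
  have clU : nbhs x [set z | closure Omega z -> U (g z)] := cg U nU.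
  by apply: filterS2 nO clU => z Oz; apply; exact: subset_closure.
move=> U; rewrite -(gE _ Ox) => nU.
have gU : nbhs x (g @^-1` U) := gx U nU.
by apply: filterS2 nO gU => z Oz /=; rewrite gE.
Qed.

Lemma Ck_bounded s : (size s <= m)%N ->
  exists M, forall x, Omega x -> `|iter_partial s sigma x| <= M.
Proof.
move=> sm; have [_ _ /(_ s sm)[g [cg gE]]] := sigma_Ck.
have cO : compact (closure Omega).
  apply: bounded_closed_compact; last exact: closed_closure.
  have [M [Mr HM]] := Omega_bounded.
  exists (M + 1); split => [|N MN x clx]; first exact: num_real.
  have cl : closed [set y : V | `|y| <= N].
    have -> : [set y : V | `|y| <= N] =
        (fun y : V => `|y|) @^-1` [set z : R | z <= N] by [].
    apply: preimage_closed => [y _|]; [exact: norm_continuous | exact: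
      closed_le].
  apply: cl; apply: closureS clx => y Oy /=.
  by apply: HM => //; apply: lt_trans MN; rewrite ltrDl.
have [M [_ HM]] := compact_bounded (continuous_compact cg cO).
exists (M + 1) => x Ox; rewrite -(gE _ Ox); apply: HM; first by rewrite ltrDl.
by exists x => //; exact: subset_closure.
Qed.

Lemma Ck_is_derive s i x (t : R) : (size s < m)%N ->
  Omega (x + t *: delta_mx 0 i) ->
  is_derive t 1 (fun u : R => iter_partial s sigma (x + u *: delta_mx 0 i))
    (iter_partial (i :: s) sigma (x + t *: delta_mx 0 i)).
Proof.
move=> sm Ox; have [_ /(_ s i _ sm Ox) dS _] := sigma_Ck.
set f := iter_partial s sigma in dS *; set e : V := delta_mx 0 i in Ox dS *.
have E : (fun h : R => h^-1 *: (((fun u : R => f (x + u *: e)) \o shift t)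
    (h *: (1 : R)) - f (x + t *: e))) =
  (fun h : R => h^-1 *: ((f \o shift (x + t *: e)) (h *: e) - f (x + t *: e))).
  apply/funext => h /=; congr (_ *: (f _ - _)).
  by rewrite [h *: 1]mulr1 scalerDl addrCA addrA addrC.
split; first by rewrite /derivable E.
by rewrite /derive E.
Qed.

End ClassCk.

(** * The kernel along coordinate lines *)

Section EuclideanNorm.
Variable R : realType.
Local Notation V := 'rV[R]_3.
Implicit Types (v : V) (d : 'I_3).

Lemma norm_coord_le_enorm v d : `|v 0 d| <= enorm v.
Proof.
rewrite -ler_sqr ?nnegrE ?enorm_ge0 // real_normK ?num_real // sqr_sqrtr.
  by rewrite (bigD1 d) //= lerDl; apply: sumr_ge0 => i _; exact: sqr_ge0.
by apply: sumr_ge0 => i _; exact: sqr_ge0.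
Qed.

Lemma enorm_line_sqr v d (u : R) :
  enorm (v + u *: delta_mx 0 d) ^+ 2 = enorm v ^+ 2 + (2 * u * v 0 d + u ^+ 2).
Proof.
rewrite !sqr_sqrtr; [|by apply: sumr_ge0 => i _; exact: sqr_ge0..].
rewrite (bigD1 d) //= [in RHS](bigD1 d) //= !mxE !eqxx mulr1.
rewrite (eq_bigr (fun i => v 0 i ^+ 2)) => [|i id].
  by rewrite sqrrD; ring.
by rewrite !mxE eqxx (negPf id) mulr0 addr0.
Qed.

Lemma enorm_delta d : enorm (delta_mx 0 d : V) = 1.
Proof.
apply/eqP; rewrite -(@eqrXn2 _ 2) ?enorm_ge0 // -[delta_mx _ _]add0r.
rewrite -[delta_mx _ _]scale1r enorm_line_sqr mxE mulr0 add0r expr1n.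
by rewrite sqr_sqrtr ?big1 ?add0r // ?sumr_ge0 // => i _; rewrite mxE expr0n.
Qed.

End EuclideanNorm.

Section KernelJets.
Variables (R : realType) (m : nat) (T : Type) (P : set T).
Local Notation V := 'rV[R]_3.
Variables (n : T -> nat) (x y : T -> V) (d : T -> 'I_3).
Variables (delta0 kappa : R).
Hypotheses (m_gt0 : (0 < m)%N) (n_gt0 : forall t, P t -> (0 < n t)%N).
Hypotheses (kappa_gt0 : 0 < kappa) (kappa_le1 : kappa <= 1).
Hypothesis kappa_small : kappa <= delta0 / 8.
Hypothesis sep : forall t, P t -> delta0 <= enorm (x t - y t).

(** Steps of length kappa / n resolve the oscillations of the harmonic of
    degree n; in the variable s all estimates become uniform in n. *)
Definition line t (s : R) : V :=
  x t + (kappa * s / (n t)%:R) *: delta_mx 0 (d t).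
Let r0 t := enorm (x t - y t).
Let r t s := enorm (line t s - y t).

Let delta0_gt0 : 0 < delta0.
Proof. by have := kappa_small; have := kappa_gt0; lra. Qed.

Let r0_gt0 t : P t -> 0 < r0 t.
Proof. by move=> Pt; exact: lt_le_trans delta0_gt0 (sep Pt). Qed.

Let nR_gt0 t : P t -> 0 < (n t)%:R :> R.
Proof. by move=> Pt; rewrite ltr0n n_gt0. Qed.

(** This is n ((r / r0)^2 - 1), in Horner form to read off its norm. *)
Let quad t : {poly R} :=
  ((0%:P * 'X + (kappa ^+ 2 / ((n t)%:R * r0 t ^+ 2))%:P) * 'X +
    (2 * kappa * (x t - y t) 0 (d t) / r0 t ^+ 2)%:P) * 'X + 0%:P.

Let quad_norm t : P t -> coef_norm (quad t) <= 1 / 2.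
Proof.
move=> Pt; rewrite !coef_normMXaddC coef_normC !normr0 add0r addr0.
have := r0_gt0 Pt; have := sep Pt; rewrite -/(r0 t).
have := norm_coord_le_enorm (x t - y t) (d t); rewrite -/(r0 t).
have : 1 <= (n t)%:R :> R by rewrite ler1n n_gt0.
set w := (x t - y t) 0 (d t); set N := (n t)%:R; set q := r0 t => N1 wq dq q0;
  have k0 := kappa_gt0.
have kq : kappa <= q / 8 by have := kappa_small; lra.
have N0 : 0 < N by lra.
have q20 : 0 < q ^+ 2 by rewrite exprn_gt0.
have kq2 : kappa ^+ 2 <= q ^+ 2 / 64.
  have -> : q ^+ 2 / 64 = (q / 8) ^+ 2 by field.
  by rewrite lerXn2r ?nnegrE //; [exact: ltW | lra].
rewrite ger0_norm; last by rewrite divr_ge0 ?mulr_ge0 ?exprn_ge0 ?ltW.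
rewrite normrM normrM normfV (@ger0_norm _ (2 * kappa)); last by lra.
rewrite (ger0_norm (ltW q20)).
have a1 : kappa ^+ 2 / (N * q ^+ 2) <= 1 / 64.
  rewrite ler_pdivrMr ?mulr_gt0 //.
  have : 0 <= (N - 1) * q ^+ 2 by apply: mulr_ge0; lra.
  by lra.
have a2 : 2 * kappa * `|w| / q ^+ 2 <= 1 / 4.
  rewrite ler_pdivrMr // expr2.
  have : 2 * kappa * `|w| <= 2 * kappa * q by rewrite ler_pM2l //; lra.
  have : 0 <= (q / 8 - kappa) * q by apply: mulr_ge0; lra.
  by lra.
lra.
Qed.

Let quadE t s : P t -> (quad t).[s] =
  (n t)%:R * ((2 * (kappa * s / (n t)%:R) * (x t - y t) 0 (d t) +
    (kappa * s / (n t)%:R) ^+ 2) / r0 t ^+ 2).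
Proof.
move=> Pt; rewrite /quad !hornerE /= invfM.
have N0 : (n t)%:R != 0 :> R by rewrite gt_eqF ?nR_gt0.
have q0 : r0 t != 0 by rewrite gt_eqF ?r0_gt0.
by set w := (x t - y t) 0 (d t); field; rewrite N0 q0.
Qed.

Let dist_quad t s : P t -> (r t s / r0 t) ^+ 2 = 1 + (quad t).[s] / (n t)%:R.
Proof.
move=> Pt; rewrite quadE //.
have N0 : (n t)%:R != 0 :> R by rewrite gt_eqF ?nR_gt0.
have q0 : r0 t != 0 by rewrite gt_eqF ?r0_gt0.
rewrite expr_div_n /r /line addrAC enorm_line_sqr -/(r0 t).
by set w := (x t - y t) 0 (d t); field; rewrite N0 q0.
Qed.

Lemma line_dist_gt0 t s : P t -> 0 <= s <= 1 -> 0 < enorm (line t s - y t).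
Proof.
move=> Pt /andP[s0 s1]; rewrite -/(r t s) lt_neqAle enorm_ge0 andbT eq_sym.
apply/eqP => rts0; have := dist_quad s Pt.
rewrite rts0 mul0r expr0n /= => /esym/eqP; rewrite gt_eqF //.
have nq : `|(quad t).[s] / (n t)%:R| <= 1 / 2.
  rewrite normrM normfV normr_nat ler_pdivrMr ?nR_gt0 //.
  have s1' : `|s| <= 1 by rewrite ger0_norm.
  apply: le_trans (horner_coef_norm _ s1') _; apply: le_trans (quad_norm Pt) _.
  by rewrite ler_peMr ?ler1n ?n_gt0 //; lra.
by move: nq; rewrite ler_norml => /andP[]; lra.
Qed.

Lemma jet_dist_powR (a : T -> R) (A : R) : 0 <= A ->
  (forall t, P t -> `|a t| <= A * (n t)%:R) ->
  jet m P (fun t s => (r t s / r0 t) `^ a t).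
Proof.
move=> A0 aA; have jq : jet m P (fun t s => (quad t).[s]).
  exact: jet_poly quad_norm.
apply: (@eq_jet _ _ _ _ (fun t s => (1 + (quad t).[s] / (n t)%:R) `^ (a t /
  2))).
  move=> t s Pt s01; rewrite -dist_quad // -powR_mulrn; last first.
    by rewrite divr_ge0 ?enorm_ge0.
  by rewrite -powRrM mulrCA mulfV ?mulr1 ?pnatr_eq0.
apply: (@jet_powR _ _ _ _ m_gt0 n _ _ (A / 2)) => //.
- by rewrite divr_ge0.
- by move=> t Pt; rewrite normrM normfV normr_nat mulrAC ler_pM2r // aA.
- have [C HC] := jet_increment m_gt0 jq; exists C => t Pt s s01.
  have -> : (quad t).[s] = (quad t).[s] - (quad t).[0].
    by rewrite [X in _ - X](_ : _ = 0) ?subr0 // /quad !hornerE.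
  exact: HC.
- move=> t s Pt /andP[s0 s1]; have s1' : `|s| <= 1 by rewrite ger0_norm.
  exact: le_trans (horner_coef_norm _ s1') (quad_norm Pt).
Qed.

Lemma jet_solid_harmonic :
  jet m P (fun t s => r t s ^+ n t *
    (legendre R (n t)).[(line t s - y t) 0 coord_z / r t s] / r0 t ^+ n t).
Proof.
exists (expR (kappa / delta0)) => t Pt.
have N0 : (n t)%:R != 0 :> R by rewrite gt_eqF ?nR_gt0.
have [q [nq qE]] := solid_harmonic_line (n t) (x t - y t) (delta_mx 0 (d t))
  (kappa / (n t)%:R).
have rn : 0 < r0 t ^+ n t by rewrite exprn_gt0 ?r0_gt0.
exists ((r0 t ^+ n t)^-1 *: q) => [|s s01].
  rewrite coef_normZ normfV (gtr0_norm rn) ler_pdivrMl //.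
  apply: le_trans nq _; rewrite enorm_delta mulr1 -/(r0 t).
  rewrite ger0_norm; last by rewrite divr_ge0 ?ltW ?nR_gt0.
  have -> : r0 t + kappa / (n t)%:R = r0 t * (1 + kappa / (n t)%:R / r0 t).
    by rewrite mulrDr mulr1 [r0 t * _]mulrC divfK // gt_eqF ?r0_gt0.
  rewrite exprMn ler_pM2l //.
  have k0 : 0 <= kappa / (n t)%:R / r0 t.
    by rewrite !divr_ge0 ?ltW ?nR_gt0 ?r0_gt0.
  apply: (@le_trans _ _ (expR (kappa / (n t)%:R / r0 t) ^+ n t)).
    by rewrite lerXn2r ?nnegrE ?expR_ge0 ?expR_ge1Dx //; lra.
  rewrite -expRM_natl ler_expR.
  have -> : (n t)%:R * (kappa / (n t)%:R / r0 t) = kappa / r0 t.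
    by field; rewrite N0 gt_eqF ?r0_gt0.
  rewrite ler_pM2l // lef_pV2 ?posrE ?r0_gt0 //; exact: sep.
have lE : x t - y t + (kappa / (n t)%:R * s) *: delta_mx 0 (d t) =
    line t s - y t by rewrite /line addrAC mulrAC.
rewrite [X in _ - X]hornerZ qE lE -/(r t s) ?gt_eqF ?line_dist_gt0 //.
rewrite mulrC subrr normr0 mulr_ge0 ?expR_ge0 ?exprn_ge0 //.
by case/andP: s01.
Qed.

(** The singular factor is split as (r / r0)^-(n + 2) times a solid harmonic:
    both vary slowly on the scale 1 / n and are bounded there, although
    neither is bounded globally. *)
Lemma jet_angular :
  jet m P (fun t s => (legendre R (n t)).[(line t s - y t) 0 coord_z / r t s] /
    r t s ^+ 2).
Proof.
have jp : jet m P (fun t s => (r t s / r0 t) `^ (- (n t + 2)%:R)).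
  apply: (@jet_dist_powR _ 3) => // t Pt.
  by rewrite normrN normr_nat -natrM ler_nat; have := n_gt0 Pt; lia.
have jc : jet m P (fun t _ => (r0 t ^+ 2)^-1).
  apply: (@jet_cst _ _ _ _ _ (delta0 ^+ 2)^-1) => t Pt.
  have r20 : 0 < r0 t ^+ 2 by rewrite exprn_gt0 ?r0_gt0.
  rewrite normfV (gtr0_norm r20) lef_pV2 ?posrE ?exprn_gt0 ?r0_gt0 //.
  by apply: lerXn2r (sep Pt); rewrite nnegrE ltW // r0_gt0.
apply: eq_jet (jetM (jetM jp jet_solid_harmonic) jc) => t s Pt s01.
have rts := line_dist_gt0 Pt s01; rewrite -/(r t s) in rts.
rewrite powRN powR_mulrn; last by rewrite divr_ge0 ?enorm_ge0.
rewrite expr_div_n !exprD.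
have q1 : r t s ^+ n t != 0 by rewrite gt_eqF ?exprn_gt0.
have q2 : r0 t ^+ n t != 0 by rewrite gt_eqF ?exprn_gt0 ?r0_gt0.
have q3 : r t s != 0 by rewrite gt_eqF.
have q4 : r0 t != 0 by rewrite gt_eqF ?r0_gt0.
set l := _.[_]; set u := r t s ^+ n t in q1 *; set v := r0 t ^+ n t in q2 *.
by field; rewrite q1 q2 q3 q4.
Qed.

Variables (Omega : set V) (sigma : V -> R).
Hypotheses (Omega_open : open Omega) (Omega_bounded : bounded_set Omega).
Hypothesis Omega_convex : convex_set Omega.
Hypothesis sigma_Ck : Ck_closure m Omega sigma.
Hypothesis y_in : forall t, P t -> Omega (y t).
Hypothesis line_in : forall t (u : R), P t -> 0 <= u <= kappa ->
  Omega (x t + u *: delta_mx 0 (d t)).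

Lemma convex_seg (p q : V) (s : R) : Omega p -> Omega q -> 0 <= s <= 1 ->
  Omega (p + s *: (q - p)).
Proof.
move=> Op Oq s01; have [s0 s1] := andP s01.
have := Omega_convex (x := q) (y := p) (Itv01 s0 s1).
rewrite !inE => /(_ Oq Op).
suff -> : p + s *: (q - p) = s *: q + (1 - s) *: p by [].
by rewrite scalerBl scale1r scalerBr addrCA.
Qed.

Lemma continuous_segment (f : V -> R) (p q : V) : Omega p -> Omega q ->
  (forall z, Omega z -> {for z, continuous f}) ->
  {within `[0, 1], continuous (fun s : R => f (p + s *: (q - p)))}.
Proof.
move=> Op Oq cf; apply: continuous_in_subspaceT => s.
rewrite inE /= in_itv /= => s01.
apply: (@continuous_comp _ _ _ (fun s : R => p + s *: (q - p)) f).
  apply: (@cvgD _ V); first exact: cvg_cst.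
  by apply: (@cvgZ _ V); [exact: cvg_id | exact: cvg_cst].
by apply: cf; exact: convex_seg.
Qed.

Let dsigma t j := iter_partial (nseq j (d t)) sigma.

Let dsigma_bounded : exists M, forall t j z, (j <= m)%N -> Omega z ->
  `|dsigma t j z| <= M.
Proof.
have Ms (i : 'I_3) (j : 'I_m.+1) : exists M, forall z, Omega z ->
    `|iter_partial (nseq j i) sigma z| <= M.
  by apply: Ck_bounded Omega_bounded sigma_Ck _ _; rewrite size_nseq -ltnS.
have [M HM] := choice (fun ij : 'I_3 * 'I_m.+1 => Ms ij.1 ij.2).
exists (\sum_ij `|M ij|) => t j z jm Oz.
have jm' : (j < m.+1)%N by [].
apply: le_trans (HM (d t, Ordinal jm') z Oz) _.
apply: le_trans (ler_norm _) _; rewrite (bigD1 (d t, Ordinal jm')) //= lerDl.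
by apply: sumr_ge0.
Qed.

(** Moving the endpoint x by tau moves the point of parameter u of the segment
    by (1 - u) tau, inside the domain by convexity; expanding there and
    integrating the Taylor coefficients over u avoids differentiating the line
    integral. *)
Lemma jet_line_integral : jet m P (fun t s =>
  unit_integral (fun u => sigma (line t s + u *: (y t - line t s)))).
Proof.
have [M HM] := dsigma_bounded.
pose phi t j (u : R) :=
  (1 - u) ^+ j / j`!%:R * dsigma t j (x t + u *: (y t - x t)).
have x_in t : P t -> Omega (x t).
  move=> Pt; rewrite -[x t]addr0 -[X in _ + X](scale0r (delta_mx 0 (d t))).
  by apply: line_in; rewrite // lexx ltW // kappa_gt0.
have cphi t j : P t -> (j <= m)%N -> {within `[0, 1], continuous (phi t j)}.
  move=> Pt jm.
  have cpow : {within `[0, 1], continuous (fun v : R => (1 - v) ^+ j / j`!%:R)}.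
    apply: continuous_subspaceT => v; apply: cvgM; last exact: cvg_cst.
    apply: (@continuous_comp _ _ _ (fun v : R => 1 - v) (fun v : R => v ^+ j)).
      by apply: cvgB; [exact: cvg_cst | exact: cvg_id].
    exact: exprn_continuous.
  have cseg : {within `[0, 1], continuous
      (fun v : R => dsigma t j (x t + v *: (y t - x t)))}.
    apply: continuous_segment; [exact: x_in | exact: y_in |] => z Oz.
    by apply: (Ck_continuous Omega_open sigma_Ck) Oz; rewrite size_nseq.
  by move=> u; apply: cvgM; [exact: cpow | exact: cseg].
pose p t : {poly R} := \poly_(j < m)
  (unit_integral (phi t j) * (kappa / (n t)%:R) ^+ j).
exists (m%:R * M + M) => t Pt.
have N0 := nR_gt0 Pt; have kN0 : 0 <= kappa / (n t)%:R.
  by rewrite divr_ge0 // ltW // kappa_gt0.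
have kN1 : kappa / (n t)%:R <= 1.
  rewrite ler_pdivrMr // mul1r (le_trans kappa_le1) // ler1n n_gt0 //.
have M0 : 0 <= M by apply: le_trans (HM t 0%N (x t) isT (x_in t Pt)).
have phiM j u : (j <= m)%N -> 0 <= u <= 1 -> `|phi t j u| <= M.
  move=> jm u01; have [u0 u1] := andP u01.
  have Oz := convex_seg (x_in t Pt) (y_in Pt) u01.
  rewrite /phi normrM -[leRHS]mul1r ler_pM // ?HM //.
  rewrite normrM normfV normr_nat normrX ger0_norm ?subr_ge0 //.
  rewrite ler_pdivrMr ?ltr0n ?fact_gt0 // mul1r.
  by rewrite (@le_trans _ _ 1) ?exprn_ile1 ?ler1n ?fact_gt0 ?subr_ge0 // gerBl.
exists (p t) => [|s s01].
  rewrite (@coef_norm_widen _ m) ?size_poly //.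
  apply: (@le_trans _ _ (\sum_(j < m) M)); last first.
    by rewrite sumr_const card_ord mulr_natl lerDl.
  apply: ler_sum => j _; rewrite coef_poly ltn_ord normrM -[leRHS]mulr1.
  apply: ler_pM => //.
    apply: norm_unit_integral; first by apply: cphi Pt _; exact: ltnW.
    by move=> u; apply: phiM; exact: ltnW.
  by rewrite ger0_norm ?exprn_ge0 // exprn_ile1.
have [s0 s1] := andP s01; set tau := kappa * s / (n t)%:R.
have tauE : tau = kappa / (n t)%:R * s by rewrite /tau mulrAC.
have tau0 : 0 <= tau by rewrite tauE mulr_ge0.
have taus : tau <= s by rewrite tauE ler_piMl.
have tauk : tau <= kappa.
  rewrite /tau ler_pdivrMr // ler_pM2l ?kappa_gt0 //.
  by rewrite (le_trans s1) // ler1n n_gt0.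
have lineE : line t s = x t + tau *: delta_mx 0 (d t) by [].
have l_in : Omega (line t s) by rewrite lineE; apply: line_in; rewrite ?tau0.
have [cS iS] := @unit_integral_sum R m (phi t) (fun j => tau ^+ j)
  (fun j jm => cphi t j Pt (ltnW jm)).
have -> : (p t).[s] = \sum_(j < m) unit_integral (phi t j) * tau ^+ j.
  rewrite horner_poly; apply: eq_bigr => j _.
  by rewrite tauE [(_ * s) ^+ j]exprMn mulrA.
have cs : {within `[0, 1],
    continuous (fun u => sigma (line t s + u *: (y t - line t s)))}.
  apply: continuous_segment l_in (y_in Pt) _ => z Oz.
  exact: (Ck_continuous Omega_open sigma_Ck (s := [::])).
rewrite -iS -unit_integralB //.
apply: (@le_trans _ _ (M * tau ^+ m)); last first.
  apply: ler_pM => //; first exact: exprn_ge0.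
    by rewrite lerDr mulr_ge0.
  by apply: lerXn2r; rewrite ?nnegrE.
apply: norm_unit_integral => [u|u u01].
  by apply: cvgB; [exact: cs | exact: cS].
have [u0 u1] := andP u01; have v0 : 0 <= 1 - u by rewrite subr_ge0.
set q := x t + u *: (y t - x t); set h := (1 - u) * tau.
have q_line (w : R) : q + ((1 - u) * w) *: delta_mx 0 (d t) =
    (x t + w *: delta_mx 0 (d t)) +
    u *: (y t - (x t + w *: delta_mx 0 (d t))).
  by apply/rowP => i; rewrite /q !mxE; ring.
have q_in (w : R) : 0 <= w <= h -> Omega (q + w *: delta_mx 0 (d t)).
  move=> /andP[w0 wh].
  pose w' := if u == 1 then 0 else w / (1 - u).
  have w'0 : 0 <= w' <= tau.
    rewrite /w'; case: eqVneq => [_|u_neq1]; first by rewrite lexx tau0.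
    have v1 : 0 < 1 - u by rewrite lt_neqAle v0 andbT eq_sym subr_eq0 eq_sym.
    by rewrite divr_ge0 //= ler_pdivrMr // mulrC.
  have -> : w = (1 - u) * w'.
    rewrite /w'; case: eqVneq => [u1'|u_neq1].
      move: wh; rewrite /h u1' subrr mul0r => wh.
      by rewrite mulr0; apply/eqP; rewrite eq_le wh w0.
    by rewrite mulrC divfK // subr_eq0 eq_sym.
  rewrite q_line; apply: convex_seg (y_in Pt) u01; apply: line_in => //.
  by case/andP: w'0 => -> /= /le_trans ->.
pose Dq j (v : R) := dsigma t j (q + v *: delta_mx 0 (d t)).
have h0 : 0 <= h by rewrite mulr_ge0.
have h_le : h <= tau by rewrite ler_piMl // gerBl.
have -> : sigma (line t s + u *: (y t - line t s)) = Dq 0%N h.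
  by rewrite /Dq /dsigma /= /h q_line -lineE.
have -> : \sum_(j < m) phi t j u * tau ^+ j = (taylor_poly m Dq).[h].
  rewrite horner_poly; apply: eq_bigr => j _.
  rewrite /phi /Dq scale0r addr0 -/q /h [((1 - u) * tau) ^+ j]exprMn.
  by rewrite [RHS]mulrA; congr (_ * _); rewrite mulrC mulrA mulrAC.
apply: (@le_trans _ _ (M * h ^+ m)); last first.
  by rewrite ler_wpM2l // lerXn2r ?nnegrE.
apply: taylor_remainder_right => // [j w jm w01|w w01].
  have sj : (size (nseq j (d t)) < m)%N by rewrite size_nseq.
  exact: (Ck_is_derive sigma_Ck sj (q_in w w01)).
by apply: HM => //; exact: q_in.
Qed.

Variable Delta : R.
Hypothesis dist_le : forall t, P t -> enorm (x t - y t) <= Delta.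

Lemma jet_kernel : jet m P (fun t s => attenuation sigma (line t s) (y t) /
  r t s ^+ 2 * (legendre R (n t)).[(line t s - y t) 0 coord_z / r t s]).
Proof.
have jr : jet m P r.
  have j1 : jet m P (fun t s => (r t s / r0 t) `^ 1).
    apply: (@jet_dist_powR (fun=> 1) 1) => // t Pt.
    by rewrite normr1 mul1r ler1n n_gt0.
  have jr0 : jet m P (fun t _ => r0 t).
    apply: (@jet_cst _ _ _ _ _ Delta) => t Pt.
    by rewrite ger0_norm ?enorm_ge0 ?dist_le.
  apply: eq_jet (jetM jr0 j1) => t s Pt _.
  rewrite powRr1 ?divr_ge0 ?enorm_ge0 // mulrC divfK // gt_eqF // r0_gt0 //.
have jneg : jet m P (fun _ _ => -1 : R).
  by apply: (@jet_cst _ _ _ _ (fun=> -1) 1) => t _; rewrite normrN1.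
have jE := jet_expR m_gt0 (jetM jneg (jetM jr jet_line_integral)).
apply: eq_jet (jetM jE jet_angular) => t s Pt s01.
by rewrite mulN1r mulrAC mulrA.
Qed.

End KernelJets.

(** * Measurability *)

Section Linfty.
Variable R : realType.
Local Notation V := 'rV[R]_3.
Local Notation M3 :=
  (measurableTypeR R * measurableTypeR R * measurableTypeR R)%type.

Lemma vec3_x (p : R * R * R) : vec3 p 0 coord_x = p.1.1.
Proof. by rewrite mxE eqxx. Qed.

Lemma vec3_y (p : R * R * R) : vec3 p 0 coord_y = p.1.2.
Proof.
rewrite mxE; case: eqP => [/(congr1 val)|_]; last by rewrite eqxx.
by rewrite /= !inordK.
Qed.

Lemma vec3_z (p : R * R * R) : vec3 p 0 coord_z = p.2.
Proof.
rewrite mxE; case: eqP => [/(congr1 val)|_]; first by rewrite /= !inordK.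
by case: eqP => [/(congr1 val)|//]; rewrite /= !inordK.
Qed.

Lemma coordP (Q : 'I_3 -> Prop) : Q coord_x -> Q coord_y -> Q coord_z ->
  forall i, Q i.
Proof.
move=> Qx Qy Qz [[|[|[|//]]] i3].
- by rewrite (_ : Ordinal i3 = coord_x) //; apply: val_inj; rewrite /= inordK.
- by rewrite (_ : Ordinal i3 = coord_y) //; apply: val_inj; rewrite /= inordK.
- by rewrite (_ : Ordinal i3 = coord_z) //; apply: val_inj; rewrite /= inordK.
Qed.

Lemma vec3K (v : V) : vec3 (v 0 coord_x, v 0 coord_y, v 0 coord_z) = v.
Proof.
apply/rowP; apply: coordP; by rewrite ?vec3_x ?vec3_y ?vec3_z.
Qed.

Lemma measurable_coords : [/\ measurable_fun [set: M3] (fun p => p.1.1),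
  measurable_fun [set: M3] (fun p => p.1.2) &
  measurable_fun [set: M3] (fun p => p.2)].
Proof.
split; last exact: measurable_snd.
  exact: (measurableT_comp measurable_fst measurable_fst).
exact: (measurableT_comp measurable_snd measurable_fst).
Qed.

(** Open sets are countable unions of boxes with rational data. *)
Lemma measurable_vec3_open (U : set V) : open U ->
  @measurable _ M3 (@vec3 R @^-1` U).
Proof.
move=> oU; pose box (c : rat * rat * rat * nat) : set M3 := [set p |
  [/\ `|p.1.1 - ratr c.1.1.1| < c.2.+1%:R^-1,
      `|p.1.2 - ratr c.1.1.2| < c.2.+1%:R^-1 &
      `|p.2 - ratr c.1.2| < c.2.+1%:R^-1]].
have mbox c : @measurable _ M3 (box c).
  have [m1 m2 m3] := measurable_coords.
  have mball (f : M3 -> R) (q e : R) : measurable_fun [set: M3] f ->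
      measurable [set p | `|f p - q| < e].
    move=> mf; rewrite -[X in measurable X]setTI.
    have -> : [set p | `|f p - q| < e] = f @^-1` (ball q e).
      by apply/seteqP; split=> p /=; rewrite -ball_normE /= distrC.
    by apply: mf => //; by rewrite ball_itv; exact: measurable_itv.
  rewrite (_ : box c = [set p | `|p.1.1 - ratr c.1.1.1| < c.2.+1%:R^-1] `&`
    [set p | `|p.1.2 - ratr c.1.1.2| < c.2.+1%:R^-1] `&`
    [set p | `|p.2 - ratr c.1.2| < c.2.+1%:R^-1]).
    by apply: measurableI; [apply: measurableI|]; exact: mball.
  by apply/seteqP; split=> p /=; [case | case=> [[]]].
pose I := [set c | box c `<=` @vec3 R @^-1` U].
have -> : @vec3 R @^-1` U = \bigcup_(c in I) box c.
  apply/seteqP; split=> [p Up|p [c Ic bp]]; last exact: Ic.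
  have /nbhs_ballP[e /= e0 eU] : nbhs (vec3 p) U by exact: open_nbhs_nbhs.
  have [k ke] : exists k : nat, k.+1%:R^-1 < e / 2.
    have := @near_infty_natSinv_lt R (PosNum (divr_gt0 e0 (ltr0n R 2))).
    by move=> [k _ /(_ k (leqnn k))] /= ke; exists k.
  have approx (z : R) : exists q : rat, `|z - ratr q| < k.+1%:R^-1.
    have zz : z - k.+1%:R^-1 < z + k.+1%:R^-1.
      by rewrite ltrD2l gtrN.
    have [q] := rat_in_itvoo zz; rewrite in_itv /= => /andP[q1 q2].
    by exists q; rewrite distrC ltr_distl q1.
  have [q1 h1] := approx p.1.1; have [q2 h2] := approx p.1.2.
  have [q3 h3] := approx p.2.
  exists (q1, q2, q3, k) => [p' [/= h1' h2' h3']|]; last by split.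
  have close (z z' q : R) : `|z - q| < k.+1%:R^-1 -> `|z' - q| < k.+1%:R^-1 ->
      `|z - z'| < e.
    move=> zq zq'; have -> : z - z' = (z - q) - (z' - q) by ring.
    apply: le_lt_trans (ler_normB _ _) _; rewrite [e]splitr.
    by apply: ltrD; [exact: lt_trans zq ke | exact: lt_trans zq' ke].
  apply: eU; split=> // i; rewrite ord1; apply: coordP;
    rewrite -ball_normE /= ?vec3_x ?vec3_y ?vec3_z.
  - exact: close h1 h1'.
  - exact: close h2 h2'.
  - exact: close h3 h3'.
rewrite bigcup_mkcond; apply: countable_bigcupT_measurable => // c.
by case: ifP.
Qed.

Lemma measurable_vec3_compact (A : set V) : compact A ->
  @measurable _ M3 (@vec3 R @^-1` A).
Proof.
move=> cA; have oA : open (~` A).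
  apply: closed_openC; apply: compact_closed cA; exact: (@norm_hausdorff R V).
have := measurableC (measurable_vec3_open oA).
by rewrite -preimage_setC setCK.
Qed.

Lemma Linfty_bounded (A : set V) (f : V -> R) B :
  @measurable _ M3 (@vec3 R @^-1` A) ->
  measurable_fun (@vec3 R @^-1` A : set M3) (f \o @vec3 R) ->
  (forall v, A v -> `|f v| <= B) -> Linfty A f.
Proof.
move=> mA mf fB; rewrite /Linfty.
have pE : patch (fun=> 0) A f \o @vec3 R =
    (f \o @vec3 R) \_ (@vec3 R @^-1` A).
  by apply/funext => p; rewrite /= !patchE.
have mp : measurable_fun [set: M3] (patch (fun=> 0) A f \o @vec3 R).
  by rewrite pE; apply/(measurable_restrictT _ mA).
rewrite inE; apply/andP; split; first by rewrite inE.
rewrite inE /= /finite_norm unlock /=; case: ifP => // _.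
apply: (@le_lt_trans _ _ (Num.max B 0)%:E); last exact: ltry.
apply/ess_supP; apply: nearW => p /=; rewrite lee_fin patchE.
case: ifPn => [/set_mem Ap|_]; first by rewrite le_max fB.
by rewrite normr0 le_max lexx orbT.
Qed.

Lemma Linfty_continuous (A : set V) (f : V -> R) : compact A ->
  (forall v, A v -> {for v, continuous f}) -> Linfty A f.
Proof.
move=> cA cf; have mA := measurable_vec3_compact cA.
have cfA : {within A, continuous f}.
  by apply: continuous_in_subspaceT => v /set_mem; exact: cf.
have [B [_ HB]] := compact_bounded (continuous_compact cfA cA).
apply: (@Linfty_bounded _ _ (B + 1)) => // [|v Av]; last first.
  by apply: HB; [rewrite ltrDl | exists v].
have E : (f \o @vec3 R : M3 -> R) = f \o @vec3 R by [].
apply: (@measurability _ _ M3 (measurableTypeR R) _ _ (@RGenOInfty.G R)).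
  by rewrite RGenOInfty.measurableE.
move=> _ [_ [c ->] <-].
pose U : set V := interior (f @^-1` `]c, +oo[).
have -> : (@vec3 R @^-1` A) `&` ((f \o @vec3 R) @^-1` `]c, +oo[) =
    (@vec3 R @^-1` A) `&` (@vec3 R @^-1` U).
  apply/seteqP; split=> p [Ap] /=.
    move=> fp; split => //; apply: (cf _ Ap).
    by apply: open_nbhs_nbhs; split => //; exact: interval_open.
  by move=> /interior_subset.
by apply: measurableI => //; apply: measurable_vec3_open; exact: open_interior.
Qed.

End Linfty.

(** * Tensor-product interpolation *)

Section Interpolation.
Variables (R : realFieldType) (m : nat).
Hypothesis m_gt0 : (0 < m)%N.

Definition node (i : nat) : R := i%:R / m%:R.

Definition ell (i : 'I_m) : {poly R} := tnth (lagrange m node) i.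

(** An upper bound for the Lebesgue constant of the nodes. *)
Definition lebesgue_cst : R := \sum_i coef_norm (ell i).

Lemma node_itv (i : 'I_m) : 0 <= node i <= 1.
Proof.
rewrite divr_ge0 //= ler_pdivrMr ?ltr0n // mul1r ler_nat.
exact: ltnW.
Qed.

Lemma ell_bounded i (u : R) : 0 <= u <= 1 -> `|(ell i).[u]| <=
  coef_norm (ell i).
Proof.
by move=> /andP[u0 u1]; apply: horner_coef_norm; rewrite ger0_norm.
Qed.

Lemma interp_exact (p : {poly R}) u : (size p <= m)%N ->
  p.[u] = \sum_(i < m) p.[node i] * (ell i).[u].
Proof.
move=> szp; have node_inj : injective node.
  move=> i j /(mulIf _) -/(_ _)/eqP; rewrite invr_eq0 pnatr_eq0 -lt0n m_gt0.
  by rewrite eqr_nat => /(_ isT)/eqP.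
rewrite {1}(lagrange_gen m_gt0 node_inj szp) horner_sum.
by apply: eq_bigr => i _; rewrite hornerM hornerC.
Qed.

Lemma sum_ell_le (c : 'I_m -> R) (e u : R) : 0 <= u <= 1 ->
  (forall i, `|c i| <= e) -> `|\sum_i c i * (ell i).[u]| <= lebesgue_cst * e.
Proof.
move=> u01 ce; apply: le_trans (ler_norm_sum _ _ _) _.
rewrite mulr_suml; apply: ler_sum => i _; rewrite normrM mulrC.
by apply: ler_pM => //; exact: ell_bounded.
Qed.

(** Interpolation needs no derivative of f, only the existence of a good
    polynomial approximation, whose coefficients may be arbitrary. *)
Lemma interp_error (f : R -> R) (p : {poly R}) (e : R) : (size p <= m)%N ->
  (forall u : R, 0 <= u <= 1 -> `|f u - p.[u]| <= e) ->
  forall u : R, 0 <= u <= 1 ->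
    `|f u - \sum_(i < m) f (node i) * (ell i).[u]| <= (1 + lebesgue_cst) * e.
Proof.
move=> szp fp u u01.
have -> : f u - \sum_(i < m) f (node i) * (ell i).[u] =
    (f u - p.[u]) - \sum_(i < m) (f (node i) - p.[node i]) * (ell i).[u].
  have -> : \sum_(i < m) (f (node i) - p.[node i]) * (ell i).[u] =
      \sum_(i < m) f (node i) * (ell i).[u] - p.[u].
    rewrite (interp_exact u szp) -sumrB.
    by apply: eq_bigr => i _; rewrite mulrBl.
  by ring.
rewrite mulrDl mul1r; apply: le_trans (ler_normB _ _) (lerD (fp u u01) _).
by apply: sum_ell_le => // i; apply: fp; exact: node_itv.
Qed.

(** The coordinates are interpolated one at a time, each new interpolation
    amplifying the previous error by at most lebesgue_cst. *)
Lemma tensor_interp_error (f : R -> R -> R -> R) (e : R) :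
  (forall u v w : R, 0 <= u <= 1 -> 0 <= v <= 1 -> 0 <= w <= 1 ->
    [/\ `|f u v w - \sum_(i < m) f (node i) v w * (ell i).[u]| <= e,
        `|f u v w - \sum_(i < m) f u (node i) w * (ell i).[v]| <= e &
        `|f u v w - \sum_(i < m) f u v (node i) * (ell i).[w]| <= e]) ->
  forall u v w : R, 0 <= u <= 1 -> 0 <= v <= 1 -> 0 <= w <= 1 ->
    `|f u v w - \sum_(i < m) \sum_(j < m) \sum_(k < m) f (node i) (node j)
      (node k) *
        ((ell i).[u] * (ell j).[v] * (ell k).[w])| <=
    (1 + lebesgue_cst + lebesgue_cst ^+ 2) * e.
Proof.
move=> fe u v w u01 v01 w01.
pose f1 := \sum_(i < m) f (node i) v w * (ell i).[u].
pose f2 := \sum_(i < m) (\sum_(j < m) f (node i) (node j) w * (ell j).[v]) *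
  (ell i).[u].
set f3 := (X in _ - X).
have f3E : f3 = \sum_(i < m) (\sum_(j < m) (\sum_(k < m) f (node i) (node j)
  (node k) *
    (ell k).[w]) * (ell j).[v]) * (ell i).[u].
  apply: eq_bigr => i _; rewrite mulr_suml; apply: eq_bigr => j _.
  rewrite mulr_suml mulr_suml; apply: eq_bigr => k _; ring.
have -> : f u v w - f3 = (f u v w - f1) + (f1 - f2) + (f2 - f3) by ring.
have [e1 _ _] := fe u v w u01 v01 w01.
rewrite !mulrDl mul1r.
apply: le_trans (ler_normD _ _) (lerD (le_trans (ler_normD _ _) _) _).
  apply: lerD => //; rewrite /f1 /f2 -sumrB.
  under eq_bigr do rewrite -mulrBl.
  apply: sum_ell_le => // i.
  by have [_ e2 _] := fe (node i) v w (node_itv i) v01 w01.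
rewrite f3E /f2 -sumrB; under eq_bigr do rewrite -mulrBl.
rewrite expr2 -mulrA; apply: sum_ell_le => // i.
rewrite -sumrB; under eq_bigr do rewrite -mulrBl.
apply: sum_ell_le => // j.
by have [_ _ e3] := fe (node i) (node j) w (node_itv i) (node_itv j) w01.
Qed.

End Interpolation.

Section Kernel.
Variables (R : realType) (m : nat).
Local Notation V := 'rV[R]_3.
Variables (Omega : set V) (sigma : V -> R).
Hypotheses (Omega_open : open Omega) (Omega_convex : convex_set Omega).
Hypothesis sigma_Ck : Ck_closure m Omega sigma.

Definition kernel n (x y : V) : R :=
  attenuation sigma x y / enorm (x - y) ^+ 2
  * Y_n0 n (polar_angle ((enorm (x - y))^-1 *: (x - y))).

Definition Y_cst n : R := Num.sqrt ((2 * n%:R + 1) / (4 * pi)).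

(** Since |z| <= r the arc cosine is undone by the cosine; for r = 0 both sides
    use 0 / 0 = 0. *)
Lemma kernelE n x y : kernel n x y = Y_cst n *
  (attenuation sigma x y / enorm (x - y) ^+ 2 *
   (legendre R n).[(x - y) 0 coord_z / enorm (x - y)]).
Proof.
rewrite /kernel /Y_n0 /polar_angle acosK.
  by rewrite mxE [_^-1 * (x - y) _ _]mulrC mulrCA.
rewrite mxE in_itv /= -ler_norml normrM normfV (ger0_norm (enorm_ge0 _)) //.
have [->|r0] := eqVneq (enorm (x - y)) 0; first by rewrite invr0 mul0r ler01.
rewrite mulrC ler_pdivrMr ?mul1r ?norm_coord_le_enorm //.
by rewrite lt_neqAle eq_sym r0 enorm_ge0.
Qed.

Lemma Y_cst_gt0 n : 0 < Y_cst n.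
Proof.
rewrite sqrtr_gt0; apply: divr_gt0; last by rewrite mulr_gt0 ?pi_gt0.
by have : 0 <= n%:R :> R by []; lra.
Qed.

Lemma Y_cst_le n : (0 < n)%N -> Y_cst n <= Num.sqrt n%:R.
Proof.
move=> n0; apply: ler_wsqrtr; have p2 := @pi_ge2 R.
have n1 : 1 <= n%:R :> R by rewrite ler1n.
rewrite ler_pdivrMr; last by lra.
have : 0 <= n%:R * (pi - 2) :> R by apply: mulr_ge0; lra.
lra.
Qed.

Lemma continuous_enorm : continuous (@enorm R).
Proof.
move=> v; apply: (@continuous_comp _ _ _ (fun v : V => \sum_(i < 3) v 0 i ^+ 2)
  (@Num.sqrt R)); last exact: sqrt_continuous.
have ci (i : 'I_3) : {for v, continuous (fun v : V => v 0 i ^+ 2)}.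
  apply: (@continuous_comp _ _ _ (fun v : V => v 0 i) (fun u : R => u ^+ 2)).
    exact: coord_continuous.
  exact: exprn_continuous.
rewrite (_ : (fun v : V => \sum_(i < 3) v 0 i ^+ 2) = fun v : V =>
    v 0 ord0 ^+ 2 + (v 0 (lift ord0 ord0) ^+ 2 +
      v 0 (lift ord0 (lift ord0 ord0)) ^+ 2)); last first.
  by apply/funext => z; rewrite !big_ord_recl big_ord0 addr0.
exact: (cvgD (ci _) (cvgD (ci _) (ci _))).
Qed.

(** Compactness of [0, 1] makes the continuity of sigma uniform along the
    segment. *)
Lemma continuous_line_integral x y : Omega x -> Omega y ->
  {for y, continuous (fun y : V =>
    unit_integral (fun s => sigma (x + s *: (y - x))))}.
Proof.
move=> Ox Oy; pose path (s : R) (z : V) : V := x + s *: (z - x).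
have cs z : Omega z -> {for z, continuous sigma}.
  exact: (Ck_continuous Omega_open sigma_Ck (s := [::])).
pose F (z : V) := unit_integral (fun s => sigma (path s z)).
suff : F @ y --> F y by [].
apply: (iffRL (cvgrPdist_le (FF := nbhs_filter y) F (F y))) => e e0.
rewrite /F.
have : \forall z \near y, `[0, 1]%classic `<=`
    (fun s => `|sigma (path s y) - sigma (path s z)| <= e).
  apply: (iffLR (compact_near_coveringP _) (@segment_compact R 0 1) V (nbhs y)
    (fun z s => `|sigma (path s y) - sigma (path s z)| <= e)).
  move=> s; rewrite /= in_itv /= => s01.
  have Os : Omega (path s y) by exact: convex_seg.
  have cpath : (fun p : R * V => path p.1 p.2) @ (s, y) --> path s y.
    apply: (@cvgD _ V); first exact: cvg_cst.
    apply: (@cvgZ _ V); first exact: cvg_fst.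
    by apply: (@cvgB _ V); [exact: cvg_snd | exact: cvg_cst].
  have cpath0 : (fun p : R * V => path p.1 y) @ (s, y) --> path s y.
    apply: (@cvgD _ V); first exact: cvg_cst.
    by apply: (@cvgZ _ V); [exact: cvg_fst | exact: cvg_cst].
  have c1 : (fun p : R * V => sigma (path p.1 p.2)) @ (s, y) -->
      sigma (path s y).
    by apply: (@cvg_comp _ _ _ _ sigma _ _ _ cpath); exact: cs.
  have c0 : (fun p : R * V => sigma (path p.1 y)) @ (s, y) --> sigma (path s y).
    by apply: (@cvg_comp _ _ _ _ sigma _ _ _ cpath0); exact: cs.
  have cd : (fun p : R * V => sigma (path p.1 y) - sigma (path p.1 p.2)) @ (s,
    y)
      --> (0 : R).
    by rewrite -(subrr (sigma (path s y))); exact: cvgB.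
  move/cvgrPdist_le : cd => /(_ e e0); apply: filterS => p /=.
  by rewrite sub0r normrN.
have nO : \forall z \near y, Omega z by exact: open_nbhs_nbhs.
move=> nz; near=> z.
have Oz : Omega z by near: z; exact: nO.
have cy := continuous_segment Omega_convex Ox Oy cs.
have cz := continuous_segment Omega_convex Ox Oz cs.
rewrite -unit_integralB //.
apply: norm_unit_integral => [s|s s01].
  by apply: cvgB; [exact: cy | exact: cz].
have H : `[0, 1]%classic `<=`
    (fun s => `|sigma (path s y) - sigma (path s z)| <= e) by near: z;
      exact: nz.
by apply: H; rewrite /= in_itv.
Unshelve. all: by end_near. Qed.

Lemma continuous_kernel n x y : Omega x -> Omega y -> enorm (x - y) != 0 ->
  {for y, continuous (kernel n x)}.
Proof.
move=> Ox Oy r0; rewrite (_ : kernel n x = fun y : V => Y_cst n *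
  (attenuation sigma x y / enorm (x - y) ^+ 2 *
   (legendre R n).[(x - y) 0 coord_z / enorm (x - y)])); last first.
  by apply/funext => z; exact: kernelE.
have FF := nbhs_filter y.
have cxy : {for y, continuous (fun z : V => x - z)}.
  exact: (cvgB (FF := FF) (cvg_cst x) cvg_id).
have cr : {for y, continuous (fun z : V => enorm (x - z))}.
  by apply: (@continuous_comp _ _ _ (fun z : V => x - z) (@enorm R)) => //;
    exact: continuous_enorm.
have cri : {for y, continuous (fun z : V => (enorm (x - z))^-1)}.
  exact: (cvgV (FF := FF)).
have cE : {for y, continuous (fun z : V => attenuation sigma x z)}.
  apply: (@continuous_comp _ _ _ (fun z : V => - (enorm (x - z) *
    unit_integral (fun s => sigma (x + s *: (z - x))))) expR).
    apply: (@cvgN _ R^o); apply: (@cvgM R) => //.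
    exact: continuous_line_integral.
  exact: continuous_expR.
have cr2 : {for y, continuous (fun z : V => (enorm (x - z) ^+ 2)^-1)}.
  apply: (@cvgV R); first by rewrite expf_neq0.
  apply: (@continuous_comp _ _ _ (fun z : V => enorm (x - z)) (fun u : R =>
    u ^+ 2)) => //.
  exact: exprn_continuous.
have cP : {for y, continuous (fun z : V =>
    (legendre R n).[(x - z) 0 coord_z / enorm (x - z)])}.
  apply: (@continuous_comp _ _ _ (fun z : V =>
    (x - z) 0 coord_z / enorm (x - z))
    (horner (legendre R n))); last exact: continuous_horner.
  apply: (@cvgM R) => //.
  apply: (@continuous_comp _ _ _ (fun z : V => x - z)
    (fun v : V => v 0 coord_z)) => //.
  exact: coord_continuous.
have cK := cvgM (FF := FF) (cvgM (FF := FF) cE cr2) cP.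
exact: (cvgM (FF := FF) (cvg_cst (Y_cst n)) cK).
Qed.

End Kernel.

(** * Piecewise interpolation on a grid of cubes *)

Section Grid.
Variables (R : realType) (m Q : nat) (h L : R).
Local Notation V := 'rV[R]_3.
Local Notation M3 :=
  (measurableTypeR R * measurableTypeR R * measurableTypeR R)%type.
Hypotheses (m_gt0 : (0 < m)%N) (h_gt0 : 0 < h).

(** A cube of the grid together with an interpolation node of that cube. *)
Definition grid_index : finType :=
  (('I_Q * 'I_Q * 'I_Q) * ('I_m * 'I_m * 'I_m))%type.

Definition slot (z : R) : nat := Num.truncn ((z + L) / h).

Definition offset (z : R) : R := (z + L) / h - (slot z)%:R.

(** Slots are half-open so that each point lies in exactly one cube. *)
Definition slot_basis (c : 'I_Q) (i : 'I_m) (z : R) : R :=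
  if c%:R <= (z + L) / h < c.+1%:R then (ell R i).[(z + L) / h - c%:R] else 0.

Definition grid_basis (j : grid_index) (x : V) : R :=
  slot_basis j.1.1.1 j.2.1.1 (x 0 coord_x) *
  slot_basis j.1.1.2 j.2.1.2 (x 0 coord_y) *
  slot_basis j.1.2 j.2.2 (x 0 coord_z).

Definition grid_point (c : nat * nat * nat) (u : R * R * R) : V :=
  vec3 (- L + h * (c.1.1%:R + u.1.1), - L + h * (c.1.2%:R + u.1.2),
        - L + h * (c.2%:R + u.2)).

Lemma offset_itv (z : R) : - L <= z -> 0 <= offset z <= 1.
Proof.
move=> zL; have t0 : 0 <= (z + L) / h by apply: divr_ge0; [lra | exact: ltW].
have /andP[a b] := truncn_itv t0.
rewrite /offset /slot subr_ge0 a /= lerBlDl -natr1 in b *.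
by rewrite ltW.
Qed.

Lemma slot_offset (z : R) : - L + h * ((slot z)%:R + offset z) = z.
Proof.
by rewrite /offset [_%:R + _]addrC subrK [h * _]mulrC divfK ?gt_eqF //
  addrC addrK.
Qed.

Lemma slot_basisE (c : 'I_Q) (i : 'I_m) (z : R) : - L <= z ->
  slot_basis c i z =
  if (c : nat) == slot z then (ell R i).[offset z] else 0.
Proof.
move=> zL; have t0 : 0 <= (z + L) / h by apply: divr_ge0; [lra | exact: ltW].
rewrite /slot_basis /offset /slot.
have -> : (c%:R <= (z + L) / h < c.+1%:R) = (Num.truncn ((z + L) / h) == c).
  by rewrite truncn_eq.
by rewrite eq_sym; case: eqP => [->|].
Qed.

Lemma slot_lt (z : R) : - L <= z <= L -> (Num.truncn (2 * L / h) < Q)%N ->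
  (slot z < Q)%N.
Proof.
move=> /andP[z0 z1]; apply: leq_ltn_trans; apply: le_truncn.
by rewrite ler_pM2r ?invr_gt0 //; lra.
Qed.

Lemma grid_sum (Psi : grid_index -> R) (x : V) (c1 c2 c3 : 'I_Q) :
  (forall i, - L <= x 0 i) ->
  slot (x 0 coord_x) = c1 -> slot (x 0 coord_y) = c2 ->
  slot (x 0 coord_z) = c3 ->
  \sum_(j : grid_index) grid_basis j x * Psi j =
  \sum_(i1 < m) \sum_(i2 < m) \sum_(i3 < m)
    Psi ((c1, c2, c3), (i1, i2, i3)) *
      ((ell R i1).[offset (x 0 coord_x)] * (ell R i2).[offset (x 0 coord_y)] *
       (ell R i3).[offset (x 0 coord_z)]).
Proof.
move=> xL s1 s2 s3.
have -> : \sum_(j : grid_index) grid_basis j x * Psi j =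
    \sum_(c : 'I_Q * 'I_Q * 'I_Q) \sum_(i : 'I_m * 'I_m * 'I_m)
      grid_basis (c, i) x * Psi (c, i).
  by rewrite pair_bigA; apply: eq_bigr => [[c i]] _.
rewrite (bigD1 (c1, c2, c3)) //= [X in _ + X]big1 => [|[[a b] d] /= neq].
  rewrite addr0 !pair_bigA /=; apply: eq_bigr => [[[i1 i2] i3]] _ /=.
  by rewrite /grid_basis /= !slot_basisE // s1 s2 s3 !eqxx mulrC.
apply: big1 => i _; rewrite /grid_basis /= !slot_basisE // s1 s2 s3.
case: eqP => [/val_inj E1|_]; last by rewrite !mul0r.
case: eqP => [/val_inj E2|_]; last by rewrite mulr0 !mul0r.
case: eqP => [/val_inj E3|_]; last by rewrite mulr0 mul0r.
by move: neq; rewrite E1 E2 E3 eqxx.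
Qed.

Lemma slot_basis_bounded c i z : `|slot_basis c i z| <= coef_norm (ell R i).
Proof.
rewrite /slot_basis; case: ifP => [/andP[a b]|_]; last first.
  by rewrite normr0 coef_norm_ge0.
apply: ell_bounded; rewrite subr_ge0 a lerBlDl -natr1 in b *.
by rewrite ltW.
Qed.

Lemma measurable_slot_basis c i :
  measurable_fun [set: measurableTypeR R] (slot_basis c i).
Proof.
have mt : measurable_fun [set: measurableTypeR R] (fun z : R => (z + L) / h).
  apply: continuous_measurable_fun => z; apply: cvgM; last exact: cvg_cst.
  by apply: cvgD; [exact: cvg_id | exact: cvg_cst].
rewrite /slot_basis; apply: measurable_fun_ifT => //.
  apply: measurable_and; first by apply: measurable_fun_ler => //.
  by apply: measurable_fun_ltr => //.
apply: (measurableT_comp (f := horner (ell R i))).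
  by apply: continuous_measurable_fun; exact: continuous_horner.
by apply: measurable_funB => //.
Qed.

Lemma Linfty_grid_basis (X : set V) j : compact X -> Linfty X (grid_basis j).
Proof.
move=> cX; have [m1 m2 m3] := measurable_coords R.
have mX := measurable_vec3_compact cX.
apply: (@Linfty_bounded _ _ _ (coef_norm (ell R j.2.1.1) *
  coef_norm (ell R j.2.1.2) * coef_norm (ell R j.2.2))) => //.
  apply: measurable_funTS.
  rewrite (_ : _ \o _ = fun p : R * R * R =>
    slot_basis j.1.1.1 j.2.1.1 p.1.1 * slot_basis j.1.1.2 j.2.1.2 p.1.2 *
    slot_basis j.1.2 j.2.2 p.2); last first.
    by apply/funext => p; rewrite /= /grid_basis vec3_x vec3_y vec3_z.
  apply: measurable_funM; first apply: measurable_funM.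
  - exact: (measurableT_comp (measurable_slot_basis _ _) m1).
  - exact: (measurableT_comp (measurable_slot_basis _ _) m2).
  - exact: (measurableT_comp (measurable_slot_basis _ _) m3).
move=> v _; rewrite !normrM; apply: ler_pM; rewrite ?mulr_ge0 //.
  by apply: ler_pM => //; exact: slot_basis_bounded.
exact: slot_basis_bounded.
Qed.

End Grid.

(** * Assembling the separable approximation *)

Section Margins.
Variable R : realType.
Local Notation V := 'rV[R]_3.

Lemma norm_coord_le (v : V) i : `|v 0 i| <= `|v|.
Proof.
rewrite [leRHS]/Num.norm /= mx_normrE.
by apply/bigmax_geP; right => /=; exists (0, i).
Qed.

Lemma enorm_le (v : V) (B : R) : 0 <= B -> (forall i, `|v 0 i| <= B) ->
  enorm v <= 2 * B.
Proof.
move=> B0 vB; rewrite -ler_sqr ?nnegrE ?enorm_ge0 ?mulr_ge0 // enorm_sqr.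
have sq i : v 0 i ^+ 2 <= B ^+ 2.
  by rewrite -[v 0 i ^+ 2]real_normK ?num_real // lerXn2r ?nnegrE ?vB.
have := sq coord_x; have := sq coord_y; have := sq coord_z.
have := sqr_ge0 B; rewrite exprMn; lra.
Qed.

Lemma bounded_coords (A : set V) : bounded_set A ->
  exists2 B : R, 0 <= B & forall v, A v -> forall i, `|v 0 i| <= B.
Proof.
move=> [M [_ HM]]; exists (Num.max (M + 1) 0);
  first by rewrite le_max lexx orbT.
move=> v Av i; apply: le_trans (norm_coord_le v i) _.
by rewrite le_max HM // ltrDl.
Qed.

(** A radius admissible at x is, once halved, admissible at all nearby points;
    compactness does the rest. *)
Lemma compact_margin (A U : set V) : compact A -> open U -> A `<=` U ->
  exists2 delta : R, 0 < delta & forall x z : V, A x ->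
    (forall i, `|z 0 i - x 0 i| < delta) -> U z.
Proof.
move=> cA oU AU.
have : \forall d \near 0^'+, A `<=` (fun x => ball x d `<=` U).
  apply: (iffLR (compact_near_coveringP A) cA R (0^'+)
    (fun d x => ball x d `<=` U)) => x Ax.
  have /nbhs_ballP[e /= e0 eU] : nbhs x U.
    by apply: open_nbhs_nbhs; split => //; exact: AU.
  exists (ball x (e / 2), [set d | d < e / 2]) => /=.
    split; first by apply: nbhsx_ballx; rewrite divr_gt0.
    by apply: nbhs_right_lt; rewrite divr_gt0.
  move=> [x' d] /= [xx' de] z x'z; apply: eU.
  rewrite [e]splitr; apply: ball_triangle xx' _.
  exact: le_ball (ltW de) _ x'z.
move=> nd; have [d [d0 dU]] : exists d : R, 0 < d /\
    A `<=` (fun x => ball x d `<=` U).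
  near (0 : R)^'+ => d; exists d; split => //.
  by near: d; exact: nd.
exists d => // x z Ax xz; apply: (dU _ Ax); split=> // i j.
by rewrite ord1 -ball_normE /= distrC.
Unshelve. all: by end_near. Qed.

End Margins.

Section Approximation.
Variables (R : realType) (m : nat).
Local Notation V := 'rV[R]_3.
Variables (Omega X Y : set V) (sigma : V -> R).
Hypotheses (m_gt0 : (0 < m)%N).
Hypotheses (Omega_open : open Omega) (Omega_bounded : bounded_set Omega).
Hypothesis Omega_convex : convex_set Omega.
Hypothesis sigma_Ck : Ck_closure m Omega sigma.
Hypotheses (X_compact : compact X) (Y_compact : compact Y).
Hypotheses (X_sub : X `<=` Omega) (Y_sub : Y `<=` Omega).
Hypothesis XY_disjoint : X `&` Y = set0.

Definition near_X (delta : R) (z : V) :=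
  exists2 x, X x & forall i, `|z 0 i - x 0 i| <= delta.

Lemma uniform_kernel_jets : exists delta kappa C : R,
  [/\ 0 < kappa <= 1, kappa <= delta, 0 <= C,
    forall z, near_X delta z -> Omega z /\ forall y, Y y -> enorm (z - y) != 0 &
    forall n x y (d : 'I_3), (0 < n)%N -> near_X delta x -> Y y ->
      exists2 p : {poly R}, coef_norm p <= C & forall s : R, 0 <= s <= 1 ->
        `|kernel sigma n (x + (kappa * s / n%:R) *: delta_mx 0 d) y / Y_cst R n
          - p.[s]| <= C * s ^+ m].
Proof.
have oU : open (Omega `\` Y).
  rewrite setDE; apply: openI => //; apply: closed_openC.
  by apply: compact_closed Y_compact; exact: (@norm_hausdorff R V).
have XU : X `<=` Omega `\` Y.
  move=> x Xx; split; first exact: X_sub.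
  by move=> Yx; have : (X `&` Y) x by []; rewrite XY_disjoint.
have [e e0 eU] := compact_margin X_compact oU XU.
(* Points within e / 4 of X are e / 2-far from Y, and kappa is an eighth of that
   distance at most, so steps of length kappa stay inside Omega. *)
pose kappa := Num.min 1 (e / 16).
have k0 : 0 < kappa by rewrite lt_min ltr01 divr_gt0.
have k1 : kappa <= 1 by rewrite ge_min lexx.
have ke : kappa <= e / 16 by rewrite ge_min lexx orbT.
have far z y : near_X (e / 4) z -> Y y -> e / 2 <= enorm (z - y).
  move=> [x Xx zx] Yy.
  have [near_y|] := pselect (forall i, `|y 0 i - x 0 i| < e).
    by have [] := eU x y Xx near_y.
  move=> /existsNP[i /negP]; rewrite -leNgt => yx.
  apply: le_trans (norm_coord_le_enorm (z - y) i); rewrite !mxE.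
  have := zx i; have := ler_distD (z 0 i) (y 0 i) (x 0 i).
  rewrite [`|y 0 i - z 0 i|]distrC; lra.
have line_in z d (u : R) : near_X (e / 4) z -> 0 <= u <= kappa ->
    Omega (z + u *: delta_mx 0 d).
  move=> [x Xx zx] /andP[u0 uk]; have [] // := eU x (z + u *: delta_mx 0 d) Xx.
  move=> i; rewrite !mxE eqxx /= addrAC.
  apply: le_lt_trans (ler_normD _ _) _.
  have : `|u * (i == d)%:R| <= u.
    by rewrite normrM (ger0_norm u0) normr_nat ler_piMr // lern1 leq_b1.
  by have := zx i; lra.
have [B B0 HB] := bounded_coords Omega_bounded.
pose T := (nat * V * V * 'I_3)%type.
pose P : set T :=
  [set t | [/\ (0 < t.1.1.1)%N, near_X (e / 4) t.1.1.2 & Y t.1.2]].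
have n0 t : P t -> (0 < t.1.1.1)%N by case.
have kd : kappa <= e / 2 / 8 by lra.
have sep t : P t -> e / 2 <= enorm (t.1.1.2 - t.1.2).
  by move=> [_ zX Yy]; exact: far.
have y_in t : P t -> Omega t.1.2 by case=> _ _; exact: Y_sub.
have l_in t (u : R) : P t -> 0 <= u <= kappa ->
    Omega (t.1.1.2 + u *: delta_mx 0 t.2).
  by move=> [_ zX _]; exact: line_in.
have near_in z : near_X (e / 4) z -> Omega z.
  move=> zX; rewrite -[z]addr0 -(scale0r (delta_mx 0 coord_x)).
  by apply: line_in => //; rewrite lexx ltW.
have dist t : P t -> enorm (t.1.1.2 - t.1.2) <= 2 * (B + B).
  move=> Pt; have [_ zX _] := Pt; apply: enorm_le => [|i];
    first exact: addr_ge0.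
  rewrite !mxE; apply: le_trans (ler_normB _ _) (lerD _ _); apply: HB.
    exact: near_in.
  exact: y_in Pt.
have [C HC] := jet_kernel m_gt0 n0 k0 k1 kd sep Omega_open Omega_bounded
  Omega_convex sigma_Ck y_in l_in dist.
exists (e / 4), kappa, (Num.max C 0); split.
- by rewrite k0.
- by lra.
- by rewrite le_max lexx orbT.
- move=> z zX; split; first exact: near_in.
  by move=> y Yy; rewrite gt_eqF // (lt_le_trans _ (far z y zX Yy)) // divr_gt0.
- move=> n x y d n_gt0 xX Yy.
  have Pt : P (n, x, y, d) by split.
  have [p np Hp] := HC _ Pt; exists p; first by rewrite le_max np.
  move=> s s01; have Y0 : Y_cst R n != 0 by rewrite gt_eqF ?Y_cst_gt0.
  rewrite kernelE mulrC mulKf //; apply: le_trans (Hp s s01) _.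
  by rewrite ler_wpM2r ?le_max ?lexx // exprn_ge0 //; case/andP: s01.
Qed.

Let coord_eqE : (coord_x == coord_y = false) * (coord_x == coord_z = false) *
  (coord_y == coord_x = false) * (coord_y == coord_z = false) *
  (coord_z == coord_x = false) * (coord_z == coord_y = false).
Proof. by do !split; rewrite -val_eqE /= !inordK. Qed.

Let grid_point_coords (h L : R) c (u : R * R * R) :
  (grid_point h L c u 0 coord_x = - L + h * (c.1.1%:R + u.1.1)) *
  (grid_point h L c u 0 coord_y = - L + h * (c.1.2%:R + u.1.2)) *
  (grid_point h L c u 0 coord_z = - L + h * (c.2%:R + u.2)).
Proof. by rewrite /grid_point vec3_x vec3_y vec3_z. Qed.

Let grid_point_line (h L : R) c (u v w t : R) :
  (grid_point h L c (u + t, v, w) =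
   grid_point h L c (u, v, w) + (h * t) *: delta_mx 0 coord_x) *
  (grid_point h L c (u, v + t, w) =
   grid_point h L c (u, v, w) + (h * t) *: delta_mx 0 coord_y) *
  (grid_point h L c (u, v, w + t) =
   grid_point h L c (u, v, w) + (h * t) *: delta_mx 0 coord_z).
Proof.
by do !split; apply/rowP; apply: coordP;
  rewrite [RHS]mxE [X in _ = _ + X]mxE [X in _ = _ + _ * X]mxE;
  rewrite !grid_point_coords;
  rewrite ?eqxx ?coord_eqE /=; ring.
Qed.

Let unit3 (u : R * R * R) :=
  [/\ 0 <= u.1.1 <= 1, 0 <= u.1.2 <= 1 & 0 <= u.2 <= 1].

Lemma near_X_cube (h L delta : R) c u v : 0 <= h <= delta ->
  unit3 u -> unit3 v -> X (grid_point h L c u) ->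
  near_X delta (grid_point h L c v).
Proof.
move=> /andP[h0 hd] [u1 u2 u3] [v1 v2 v3] Xu; exists (grid_point h L c u) => //.
have diff (a b k : R) : 0 <= a <= 1 -> 0 <= b <= 1 ->
    `|- L + h * (k + a) - (- L + h * (k + b))| <= delta.
  move=> /andP[a0 a1] /andP[b0 b1].
  have -> : - L + h * (k + a) - (- L + h * (k + b)) = h * (a - b) by ring.
  rewrite normrM (ger0_norm h0); apply: le_trans hd; rewrite ler_piMr //.
  by rewrite ler_norml; lra.
by apply: coordP; rewrite !grid_point_coords; exact: diff.
Qed.

(** Each of the three interpolations starts from a face of the cube, where one
    local coordinate vanishes; there the expansion in s becomes a polynomial in
    the local coordinate t through s = lambda t. *)
Lemma cube_error (delta kappa C lambda L : R) n c (y : V) (u v w : R)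
    (K : R * R * R -> R) :
  0 < kappa -> kappa <= delta -> 0 <= lambda <= 1 -> (0 < n)%N -> 0 <= C ->
  (forall n x y (d : 'I_3), (0 < n)%N -> near_X delta x -> Y y ->
     exists2 p : {poly R}, coef_norm p <= C & forall s : R, 0 <= s <= 1 ->
       `|kernel sigma n (x + (kappa * s / n%:R) *: delta_mx 0 d) y / Y_cst R n
         - p.[s]| <= C * s ^+ m) ->
  0 <= u <= 1 -> 0 <= v <= 1 -> 0 <= w <= 1 ->
  X (grid_point (kappa * lambda / n%:R) L c (u, v, w)) -> Y y ->
  (forall p, K p = kernel sigma n
     (grid_point (kappa * lambda / n%:R) L c p) y / Y_cst R n) ->
  `|K (u, v, w) - \sum_(i < m) \sum_(j < m) \sum_(k < m)
      K (node R m i, node R m j, node R m k) *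
      ((ell R i).[u] * (ell R j).[v] * (ell R k).[w])| <=
  (1 + lebesgue_cst R m + lebesgue_cst R m ^+ 2) *
    ((1 + lebesgue_cst R m) * (2 * C * lambda ^+ m)).
Proof.
move=> k0 kd l01 n0 C0 HC u01 v01 w01 Xx Yy; set h := kappa * lambda / n%:R.
move=> KE; have [l0 l1] := andP l01.
have N0 : 0 < n%:R :> R by rewrite ltr0n.
have h0 : 0 <= h by rewrite !mulr_ge0 ?invr_ge0 // ltW.
have hd : h <= delta.
  apply: le_trans kd; rewrite /h ler_pdivrMr // ler_pM2l //.
  by rewrite (le_trans l1) // ler1n.
have near_cube (a b e : R) : 0 <= a <= 1 -> 0 <= b <= 1 -> 0 <= e <= 1 ->
    near_X delta (grid_point h L c (a, b, e)).
  by move=> *; apply: near_X_cube Xx => //; rewrite h0.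
have line_error d (z : V) (g : R -> V) : near_X delta z ->
    (forall t, g t = z + (h * t) *: delta_mx 0 d) ->
    forall t : R, 0 <= t <= 1 ->
    `|kernel sigma n (g t) y / Y_cst R n -
      \sum_(i < m) kernel sigma n (g (node R m i)) y / Y_cst R n *
        (ell R i).[t]| <=
    (1 + lebesgue_cst R m) * (2 * C * lambda ^+ m).
  move=> zX gE; have [p np Hp] := HC n z y d n0 zX Yy.
  pose q : {poly R} := \poly_(i < m) (p`_i * lambda ^+ i).
  apply: (@interp_error _ _ m_gt0 (fun t =>
    kernel sigma n (g t) y / Y_cst R n) q).
    exact: size_poly.
  move=> t t01; have [t0 t1] := andP t01.
  have s01 : 0 <= lambda * t <= 1 by rewrite mulr_ge0 //= mulr_ile1.
  have -> : q.[t] = (take_poly m p).[lambda * t].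
    rewrite !horner_poly; apply: eq_bigr => i _.
    by rewrite exprMn mulrA.
  rewrite gE; have -> : h * t = kappa * (lambda * t) / n%:R by rewrite /h; ring.
  rewrite -(subrK p.[lambda * t] (_ / _)) -addrA.
  have sl : (lambda * t) ^+ m <= lambda ^+ m.
    by rewrite lerXn2r ?nnegrE ?mulr_ge0 // ler_piMr.
  have -> : 2 * C * lambda ^+ m = C * lambda ^+ m + C * lambda ^+ m by ring.
  apply: le_trans (ler_normD _ _) (lerD _ _).
    apply: le_trans (Hp _ s01) _; exact: ler_wpM2l.
  have s1 : `|lambda * t| <= 1 by rewrite ger0_norm //; case/andP: s01.
  apply: le_trans (horner_take_poly m p s1) _.
  rewrite ger0_norm ?mulr_ge0 // ler_pM ?coef_norm_ge0 ?exprn_ge0 ?mulr_ge0 //.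
apply: (@tensor_interp_error _ _ m_gt0 (fun a b e => K (a, b, e))) => //.
move=> a b e a01 b01 e01.
have z01 : 0 <= (0 : R) <= 1 by rewrite lexx ler01.
split; rewrite KE; under eq_bigr do rewrite KE.
- apply: (line_error coord_x (grid_point h L c (0, b, e))
    (fun t => grid_point h L c (t, b, e))) => // [|t]; first exact: near_cube.
  by rewrite -grid_point_line add0r.
- apply: (line_error coord_y (grid_point h L c (a, 0, e))
    (fun t => grid_point h L c (a, t, e))) => // [|t]; first exact: near_cube.
  by rewrite -grid_point_line add0r.
- apply: (line_error coord_z (grid_point h L c (a, b, 0))
    (fun t => grid_point h L c (a, b, t))) => // [|t]; first exact: near_cube.
  by rewrite -grid_point_line add0r.
Qed.

(** The cubes are scaled by kappa / n, the length on which the kernel has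
    uniform expansions; the factor lambda is left to be chosen from the
    accuracy. *)
Lemma separable_kernel : exists kappa C L : R,
  [/\ 0 < kappa <= 1, 1 <= C, 0 <= L &
    forall n (lambda : R), (0 < n)%N -> 0 < lambda <= 1 ->
    let h := kappa * lambda / n%:R in
    let J := grid_index m (Num.truncn (2 * L / h)).+1 in
    exists f g : J -> V -> R,
      [/\ forall j, Linfty X (f j), forall j, Linfty Y (g j) &
        forall x y, X x -> Y y ->
          `|kernel sigma n x y - \sum_j f j x * g j y| <=
          C * Num.sqrt n%:R * lambda ^+ m]].
Proof.
have [delta [kappa [C [/andP[k0 k1] kd C0 nearX HC]]]] := uniform_kernel_jets.
have [L L0 HL] := bounded_coords Omega_bounded.
pose La := lebesgue_cst R m.
pose C1 := (1 + La + La ^+ 2) * ((1 + La) * (2 * C)).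
exists kappa, (Num.max 1 C1), L; split => //; first by rewrite k0.
  by rewrite le_max lexx.
move=> n lambda n0 /andP[l0 l1] h J.
have N0 : 0 < n%:R :> R by rewrite ltr0n.
have h0 : 0 < h by rewrite !mulr_gt0 ?invr_gt0.
have hd : 0 <= h <= delta.
  rewrite (ltW h0) /=; apply: le_trans kd; rewrite /h ler_pdivrMr //
    ler_pM2l //.
  by rewrite (le_trans l1) // ler1n.
pose cube (j : J) : nat * nat * nat :=
  (j.1.1.1 : nat, j.1.1.2 : nat, j.1.2 : nat).
pose nodes (j : J) : R * R * R :=
  (node R m j.2.1.1, node R m j.2.1.2, node R m j.2.2).
have nodes01 j : unit3 (nodes j) by split; exact: node_itv.
pose meets (j : J) := exists2 u, unit3 u & X (grid_point h L (cube j) u).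
(* The nodes of a cube that misses X may lie outside Omega or in Y. *)
pose g (j : J) (y : V) : R :=
  if `[< meets j >] then kernel sigma n (grid_point h L (cube j) (nodes j)) y
  else 0.
exists (fun j => grid_basis h L j), g; split.
- by move=> j; exact: Linfty_grid_basis.
- move=> j; apply: Linfty_continuous => // y Yy; rewrite /g.
  case: asboolP => [[u u01 Xu]|_]; last exact: cst_continuous.
  have [Oz zy] := nearX _ (near_X_cube hd u01 (nodes01 j) Xu).
  apply: (continuous_kernel Omega_open Omega_convex sigma_Ck) => //.
    exact: Y_sub.
  exact: zy.
move=> x y Xx Yy; have xL (i : 'I_3) : - L <= x 0 i <= L.
  by rewrite -ler_norml; apply: HL; exact: X_sub.
have xL' (i : 'I_3) : - L <= x 0 i by case/andP: (xL i).
have sQ (i : 'I_3) : (slot h L (x 0%R i) < (Num.truncn (2 * L / h)).+1)%N.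
  exact: (slot_lt h0 (xL i) (ltnSn _)).
pose c (i : 'I_3) := Ordinal (sQ i).
rewrite (grid_sum h0 (fun j => g j y) (c1 := c coord_x) (c2 := c coord_y)
  (c3 := c coord_z) xL' (erefl _) (erefl _) (erefl _)).
pose o (i : 'I_3) := offset h L (x 0 i).
pose ox := (o coord_x, o coord_y, o coord_z).
pose cn : nat * nat * nat :=
  (c coord_x : nat, c coord_y : nat, c coord_z : nat).
have o01 i : 0 <= o i <= 1 by exact: offset_itv.
have xE : grid_point h L cn ox = x.
  by rewrite /grid_point /= !slot_offset // vec3K.
pose K p := kernel sigma n (grid_point h L cn p) y / Y_cst R n.
have Y0 : Y_cst R n != 0 by rewrite gt_eqF ?Y_cst_gt0.
have gE i1 i2 i3 : g ((c coord_x, c coord_y, c coord_z), (i1, i2, i3)) y =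
    Y_cst R n * K (node R m i1, node R m i2, node R m i3).
  rewrite /g asboolT; first by rewrite /K [Y_cst R n * _]mulrC divfK.
  exists ox; first by split; exact: o01.
  by rewrite -[cube _]/cn xE.
have -> : kernel sigma n x y = Y_cst R n * K ox by rewrite /K xE [Y_cst R n *
  _]mulrC divfK.
set S := \sum_(i1 < m) _.
have -> : S = Y_cst R n * \sum_(i < m) \sum_(j < m) \sum_(k < m)
    K (node R m i, node R m j, node R m k) *
    ((ell R i).[o coord_x] * (ell R j).[o coord_y] * (ell R k).[o coord_z]).
  rewrite /S mulr_sumr; apply: eq_bigr => i1 _.
  rewrite mulr_sumr; apply: eq_bigr => i2 _.
  rewrite mulr_sumr; apply: eq_bigr => i3 _.
  by rewrite gE -[LHS]mulrA.
rewrite -mulrBr normrM ger0_norm ?sqrtr_ge0 // [_ * Num.sqrt _]mulrC -mulrA.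
apply: ler_pM; rewrite ?sqrtr_ge0 ?Y_cst_le //.
have Xo : X (grid_point h L cn ox) by rewrite xE.
have := @cube_error delta kappa C lambda L n cn y (o coord_x) (o coord_y)
  (o coord_z) K k0 kd _ n0 C0 HC (o01 _) (o01 _) (o01 _) Xo Yy (fun p =>
    erefl _).
rewrite ltW //= => /(_ l1) E; apply: le_trans E _.
apply: (@le_trans _ _ (C1 * lambda ^+ m)); first by rewrite /C1 -!mulrA.
by rewrite ler_wpM2r ?exprn_ge0 ?le_max ?lexx ?orbT // ltW.
Qed.

End Approximation.

Lemma grid_count (R : realType) (m n : nat) (kappa L lambda : R) :
  0 < kappa <= 1 -> 0 <= L -> (0 < n)%N -> 0 < lambda <= 1 ->
  #|grid_index m (Num.truncn (2 * L / (kappa * lambda / n%:R))).+1|%:R <=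
  ((2 * L + 1) / kappa) ^+ 3 * m%:R ^+ 3 * n%:R ^+ 3 * lambda^-1 ^+ 3.
Proof.
move=> /andP[k0 k1] L0 n0 /andP[l0 l1]; set h := kappa * lambda / n%:R.
have N0 : 0 < n%:R :> R by rewrite ltr0n.
have h0 : 0 < h by rewrite !mulr_gt0 ?invr_gt0.
have h1 : h <= 1.
  by rewrite ler_pdivrMr // mul1r (le_trans (mulr_ile1 _ _ _ _)) ?ler1n // ltW.
set Q := (Num.truncn _).+1.
have QE : Q%:R <= (2 * L + 1) / h.
  rewrite /Q -natr1 [leRHS]mulrDl lerD //.
    by rewrite truncn_le mulr_ge0 ?invr_ge0 ?mulr_ge0 // ltW.
  by rewrite mul1r invf_ge1.
rewrite !card_prod !card_ord !natrM.
have -> : ((2 * L + 1) / kappa) ^+ 3 * m%:R ^+ 3 * n%:R ^+ 3 * lambda^-1 ^+ 3 =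
    ((2 * L + 1) / h) ^+ 3 * m%:R ^+ 3.
  by rewrite /h; field; rewrite !gt_eqF.
have -> : Q%:R * Q%:R * Q%:R * (m%:R * m%:R * m%:R) =
  Q%:R ^+ 3 * m%:R ^+ 3 :> R by ring.
by rewrite ler_wpM2r ?exprn_ge0 // lerXn2r ?nnegrE // (le_trans _ QE).
Qed.

(** The exponent 3 / m is at most 2, so the normalisation of the harmonics
    contributes at most a factor n to the number of cubes. *)
Lemma step_size_bound (R : realType) (m n : nat) (C eps : R) : (1 < m)%N ->
  1 <= C -> (0 < n)%N -> 0 < eps <= 1 ->
  let lambda := (eps / (C * Num.sqrt n%:R)) `^ m%:R^-1 in
  [/\ 0 < lambda <= 1, C * Num.sqrt n%:R * lambda ^+ m = eps &
    lambda^-1 ^+ 3 <= C ^+ 2 * n%:R * eps `^ (- (6 / m%:R))].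
Proof.
move=> m1 C1 n0 /andP[e0 e1] lambda.
have C0 : 0 < C by rewrite (lt_le_trans ltr01).
have s1 : 1 <= Num.sqrt n%:R :> R by rewrite -[leLHS]sqrtr1 ler_wsqrtr // ler1n.
have s0 : 0 < Num.sqrt n%:R :> R by rewrite (lt_le_trans ltr01).
have Cs0 : 0 < C * Num.sqrt n%:R by rewrite mulr_gt0.
have M0 : 0 < m%:R :> R by rewrite ltr0n ltnW.
have M2 : 2 <= m%:R :> R by rewrite ler_nat.
have A0 : 0 < eps / (C * Num.sqrt n%:R) by rewrite divr_gt0.
split.
- rewrite powR_gt0 //= -[leRHS](congr1 (fun f => f m%:R^-1) (@powR1 R));
  apply: ge0_ler_powR.
  + by rewrite invr_ge0.
  + by rewrite nnegrE ltW.
  + by rewrite nnegrE.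
  + by rewrite ler_pdivrMr // mul1r (le_trans e1) // (le_trans C1) //
    ler_peMr // ltW.
- rewrite /lambda -powR_mulrn ?powR_ge0 // -powRrM mulVf ?gt_eqF //
  powRr1 ?ltW //.
  by rewrite mulrC divfK ?gt_eqF.
have inv (a r : R) : 0 < a -> (a `^ r)^-1 = a^-1 `^ r.
  by move=> a0; rewrite -powRN -mulN1r powRrM powR_inv1 // ltW.
rewrite /lambda inv // -[leLHS]powR_mulrn ?powR_ge0 //
  -[leLHS]powRrM powRN inv //.
set p := m%:R^-1 * 3.
have p0 : 0 <= p by rewrite mulr_ge0 ?invr_ge0.
have p2 : p <= 2 by rewrite /p mulrC ler_pdivrMr //; lra.
have -> : 6 / m%:R = p + p by rewrite /p; ring.
have e1' : 1 <= eps^-1 by rewrite invf_ge1.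
rewrite invf_div powRM ?invr_ge0 ?(ltW Cs0) ?(ltW e0) //
  powRM ?(ltW C0) ?(ltW s0) //.
apply: ler_pM; rewrite ?mulr_ge0 ?powR_ge0 //.
  apply: ler_pM; rewrite ?powR_ge0 //.
    by rewrite -powR_mulrn ?(ltW C0) // ler_powR.
  have nE : n%:R = Num.sqrt n%:R `^ 2%:R :> R.
    by rewrite powR_mulrn ?sqr_sqrtr ?(ltW s0).
  by rewrite [leRHS]nE; exact: ler_powR.
by apply: ler_powR; rewrite // lerDl.
Qed.

Theorem theorem3p18 (R : realType)
    (Omega : set 'rV[R]_3)
    (Omega_open : open Omega) (Omega_neq0 : Omega !=set0)
    (Omega_bounded : bounded_set Omega) (Omega_convex : convex_set Omega)
    (k : nat) (k_ge1 : (1 <= k)%N)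
    (sigma_t : 'rV[R]_3 -> R) (sigma_t_Ck : Ck_closure k.+1 Omega sigma_t)
    (sigma0 sigma1 : R) (sigma0_gt0 : 0 < sigma0)
    (sigma_t_bounds : forall x, closure Omega x ->
       sigma0 <= sigma_t x <= sigma1)
    (X Y : set 'rV[R]_3) (X_compact : compact X) (Y_compact : compact Y)
    (X_sub : X `<=` Omega) (Y_sub : Y `<=` Omega)
    (XY_disjoint : X `&` Y = set0)
    (xc yc : 'rV[R]_3) (xcX : X xc) (ycY : Y yc)
    (rho zeta eta : R)
    (rhoE : enorm (xc - yc) = rho)
    (zetaE : sup [set enorm (xc - x) | x in X] = zeta)
    (etaE : sup [set enorm (yc - y) | y in Y] = eta)
    (sep : (zeta + eta) / rho < 1 / 2) :
  exists C eps0 : R, [/\ 0 < C, 0 < eps0 &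
    forall n : nat, (1 <= n)%N -> forall eps : R, 0 < eps ->
    exists (N : nat) (f g : 'I_N -> 'rV[R]_3 -> R),
      [/\ eps < eps0 ->
            N%:R <= C * (n%:R + `|ln eps|) ^+ 4 * eps `^ (- (6 / k.+1%:R)),
          forall l, Linfty X (f l),
          forall l, Linfty Y (g l)
        & forall x y, X x -> Y y ->
            `| attenuation sigma_t x y / enorm (x - y) ^+ 2
               * Y_n0 n (polar_angle ((enorm (x - y))^-1 *: (x - y)))
               - \sum_(l < N) f l x * g l y | <= eps ]].
Proof.
have [kappa [C1 [L [k01 C11 L0 HS]]]] := separable_kernel (ltn0Sn k) Omega_open
  Omega_bounded Omega_convex sigma_t_Ck X_compact Y_compact X_sub Y_sub
  XY_disjoint.
have C10 : 0 < C1 by rewrite (lt_le_trans ltr01).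
have [k0 _] := andP k01.
exists (((2 * L + 1) / kappa) ^+ 3 * k.+1%:R ^+ 3 * C1 ^+ 2), (1 / 2).
have A0 : 0 < (2 * L + 1) / kappa by apply: divr_gt0; lra.
split; first by apply: mulr_gt0; [apply: mulr_gt0|]; apply: exprn_gt0.
  by lra.
(* For eps >= 1 / 2 the construction is run with accuracy 1 / 2: the number of
   terms is then irrelevant, and the step size must stay below 1. *)
move=> n n1 eps e0; set e' := Num.min eps (1 / 2).
have e'0 : 0 < e' by rewrite lt_min e0 divr_gt0.
have e'1 : e' <= 1.
  by apply: (@le_trans _ _ (1 / 2)); [rewrite ge_min lexx orbT | lra].
have [l01 lE lN] := @step_size_bound R k.+1 n C1 e' k_ge1 C11 n1
  (introT andP (conj e'0 e'1)).
have [F [G [LF LG FG]]] := HS n _ n1 l01.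
set J := grid_index _ _ in F G LF LG FG.
exists #|J|, (fun l => F (enum_val l)), (fun l => G (enum_val l)); split.
- move=> e_small.
  have e'E : e' = eps by rewrite /e' min_l // ltW.
  have := @grid_count R k.+1 n kappa L _ k01 L0 n1 l01; rewrite -/J => cN.
  rewrite [X in _ * (X `^ _)]e'E in lN; apply: le_trans cN _.
  set A := ((2 * L + 1) / kappa) ^+ 3 * k.+1%:R ^+ 3.
  have AA : 0 <= A by rewrite mulr_ge0 ?exprn_ge0 // ltW.
  apply: (@le_trans _ _ (A * n%:R ^+ 3 *
      (C1 ^+ 2 * n%:R * eps `^ (- (6 / k.+1%:R))))).
    by apply: ler_wpM2l lN; rewrite mulr_ge0 ?exprn_ge0.
  have -> : A * n%:R ^+ 3 * (C1 ^+ 2 * n%:R * eps `^ (- (6 / k.+1%:R))) =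
    A * C1 ^+ 2 * n%:R ^+ 4 * eps `^ (- (6 / k.+1%:R)) by ring.
  apply: ler_wpM2r; first exact: powR_ge0.
  apply: ler_wpM2l; first by rewrite mulr_ge0 // exprn_ge0 // ltW.
  by apply: lerXn2r; rewrite ?nnegrE ?addr_ge0 ?lerDl.
- by move=> l; exact: LF.
- by move=> l; exact: LG.
move=> x y Xx Yy; have := FG x y Xx Yy; rewrite lE => E.
have -> : \sum_(l < #|J|) F (enum_val l) x * G (enum_val l) y =
    \sum_j F j x * G j y.
  by rewrite -(big_enum_val (A := J) (fun j => F j x * G j y)).
by apply: le_trans E _; rewrite ge_min lexx.
Qed.
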